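(* Let $\overline\Pi$ be an $\alpha$-self-similar multi-type fragmentation process with $\alpha<0$, started from the single block $\mathbb N$ with any type $i\in[K]$ (law $\mathbb P_i$). Let $$\zeta=\inf\big\{t\ge0:\ \Pi(t)=\{\{1\},\{2\},\dots\}\big\}.$$ Then $\zeta$ is finite a.s. and has some finite exponential moments, i.e. there exists $a>0$ such that $\mathbb E_i[e^{a\zeta}]<\infty$.
   Context: Fix $K\in\mathbb N=\{1,2,\dots\}$ and $[K]=\{1,\dots,K\}$. Partitions. $\overline{\mathcal P}_{\mathbb N}$ is the set of $\bar\pi=(\pi,\mathbf i)=(\pi_n,i_n)_{n\in\mathbb N}$ where $\pi_1,\pi_2,\dots$ are the blocks of a partition $\pi$ of $\mathbb N$ in increasing order of least element (completed by empty sets), and $i_n\in\{0,\dots,K\}$ is the type of $\pi_n$, with $i_n=0$ iff $\pi_n$ is empty or a singleton; partitions of subsets of $\mathbb N$ are defined likewise. $\pi_{(m)}$ is the block containing $m$. For $A\subset\mathbb N$, $\bar\pi\cap A$ is the partition of $A$ obtained by intersecting blocks with $A$, types being inherited except that empty sets and singletons get type $0$. With $[n]=\{1,\dots,n\}$, the metric on $\overline{\mathcal P}_{\mathbb N}$ is $d(\bar\pi,\bar\pi')=1/\sup\{n:\bar\pi\cap[n]=\bar\pi'\cap[n]\}$. The asymptotic frequency of a block $B$ is $|B|=\lim_n\#(B\cap[n])/n$ when it exists. For a bijection $\sigma$ of $\mathbb N$, $\sigma\bar\pi$ has as blocks the inverse images by $\sigma$ of the blocks of $\bar\pi$, with inherited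 types; a random process of partitions is exchangeable if its law is invariant under all $\sigma$. Fragmentations. For $\alpha\in\mathbb R$, an $\alpha$-self-similar (multi-type) fragmentation process is a c\`adl\`ag $\overline{\mathcal P}_{\mathbb N}$-valued Markov process $\overline\Pi=(\overline\Pi(t),t\ge0)$, with law $\mathbb P_{\bar\pi}$ when started from $\bar\pi$ and $\mathbb P_i$ (expectation $\mathbb E_i$) when started from the single block $\mathbb N$ of type $i\in[K]$, such that with probability $1$, for all $n$, the asymptotic frequency $|\Pi_{(n)}(t)|$ exists for all $t\ge0$ and is right-continuous in $t$, which is exchangeable as a process, and such that under $\mathbb P_{\bar\pi}$ the processes $(\overline\Pi(t)\cap\pi_n)_{t\ge0}$, $n\in\mathbb N$, are independent, the $n$-th having the law of $(\overline\Pi(|\pi_n|^\alpha t)\cap\pi_n)_{t\ge0}$ under $\mathbb P_{i_n}$. Here $\Pi(t)$ is the untyped partition underlying $\overline\Pi(t)$. The degenerate case where $(\Pi(t),t\ge0)$ is a.s. constant (only the type changes) is excluded. *)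

(* Defs.v *)
From HB Require Import structures.
From mathcomp Require Import all_boot all_order all_algebra.
From mathcomp Require Import finmap.
From mathcomp Require Import all_classical all_reals all_analysis.
From mathcomp Require Import measurable_realfun.

Set Implicit Arguments.
Unset Strict Implicit.
Unset Printing Implicit Defensive.

Import Order.TTheory GRing.Theory Num.Theory.
Import numFieldNormedType.Exports.

Local Open Scope classical_set_scope.
Local Open Scope ring_scope.

(* The integer k >= 1 of the mathematical text is represented by k - 1 : nat,
   so that [n] = {1, ..., n} is `I_n.  A typed partition of A is encoded by the
   maps sending m in A to its block cls m (set0 if m is not in A) and to the
   type typ m of that block.  Types live in {0, ..., K} = 'I_K.+1, and the type
   i in [K] = 'I_K is lift ord0 i, the type 0 being ord0. *)
Record typed_partition (K : nat) (A : set nat) := TypedPartition {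
  cls : nat -> set nat ;
  typ : nat -> 'I_K.+1 ;
  cls_dom : forall m j, cls m j -> A m ;
  cls_refl : forall m, A m -> cls m m ;
  cls_eq : forall m j, cls m j -> cls j = cls m ;
  typ_eq : forall m j, cls m j -> typ j = typ m ;
  typ0P : forall m, typ m = ord0 <-> cls m `<=` [set m] }.

Lemma partition_ext K A (p q : typed_partition K A) :
  (forall m, cls p m = cls q m) -> (forall m, typ p m = typ q m) -> p = q.
Proof.
case: p q => [c t a1 a2 a3 a4 a5] [c' t' b1 b2 b3 b4 b5] /= /funext E /funext F.
by subst c' t'; congr TypedPartition; exact: Prop_irrelevance.
Qed.

Section operations.
Variables (K : nat).

(* The least elements of the blocks. *)
Definition leader A (p : typed_partition K A) (m : nat) : Prop :=
  cls p m m /\ forall j, cls p m j -> (m <= j)%N.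

(* The n-th block in increasing order of least element (set0 once the blocks
   are exhausted): its least element is preceded by exactly n leaders. *)
Definition block A (p : typed_partition K A) (n : nat) : set nat :=
  [set x | exists m, [/\ leader p m,
     #|[pred j : 'I_m | `[< leader p j >]]| = n & cls p m x]].

(* typ p is constant on the block; xget gives ord0 on an empty one. *)
Definition btype A (p : typed_partition K A) (n : nat) : 'I_K.+1 :=
  xget ord0 (typ p @` block p n).

Section restriction.
Variables (A B : set nat) (p : typed_partition K A).

Let rcls m : set nat := [set j | [/\ B m, B j & cls p m j]].
Let rtyp m : 'I_K.+1 := if `[< rcls m `<=` [set m] >] then ord0 else typ p m.

Let rcls_dom m j : rcls m j -> (A `&` B) m.
Proof. by move=> [Bm _ /cls_dom]. Qed.

Let rcls_refl m : (A `&` B) m -> rcls m m.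
Proof. by move=> [Am Bm]; split=> //; exact: cls_refl. Qed.

Let rcls_eq m j : rcls m j -> rcls j = rcls m.
Proof.
by move=> [Bm Bj mj]; apply/seteqP; split=> k [_ Bk kj]; split=> //;
  move: kj; rewrite (cls_eq mj).
Qed.

Let rcls_single m j : rcls m j -> rcls m `<=` [set m] -> rcls j `<=` [set j].
Proof. by move=> mj sm; rewrite (rcls_eq mj) (sm _ mj). Qed.

Let rtyp_eq m j : rcls m j -> rtyp j = rtyp m.
Proof.
move=> mj; have jm : rcls j m.
  by case: (mj) => Bm Bj h; split=> //; rewrite (cls_eq h);
     exact/cls_refl/(cls_dom h).
rewrite /rtyp; case: asboolP => sj; case: asboolP => sm //.
- by case: sm; exact: rcls_single jm sj.
- by case: sj; exact: rcls_single mj sm.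
- by case: mj => _ _ /typ_eq.
Qed.

Let rtyp0P m : rtyp m = ord0 <-> rcls m `<=` [set m].
Proof.
rewrite /rtyp; case: asboolP => sm; split=> // /typ0P h.
by case: sm => j [_ _ /h].
Qed.

Definition restr : typed_partition K (A `&` B) :=
  TypedPartition rcls_dom rcls_refl rcls_eq rtyp_eq rtyp0P.

End restriction.

Section relabelling.
Variables (s : nat -> nat) (sB : bijective s) (p : typed_partition K setT).

Let scls m : set nat := s @^-1` cls p (s m).
Let styp m : 'I_K.+1 := typ p (s m).

Let scls_dom m j : scls m j -> [set: nat] m. Proof. by []. Qed.

Let scls_refl m : [set: nat] m -> scls m m.
Proof. by move=> _; exact: cls_refl. Qed.

Let scls_eq m j : scls m j -> scls j = scls m.
Proof. by rewrite /scls => /cls_eq ->. Qed.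

Let styp_eq m j : scls m j -> styp j = styp m.
Proof. by move=> /typ_eq. Qed.

Let styp0P m : styp m = ord0 <-> scls m `<=` [set m].
Proof.
rewrite /styp typ0P; split=> h j.
  by move=> /h /(bij_inj sB).
by case: sB => g sg gs; rewrite -[j]gs => /h ->.
Qed.

(* The partition s p: its blocks are the inverse images s^{-1}(b). *)
Definition relabel : typed_partition K setT :=
  TypedPartition scls_dom scls_refl scls_eq styp_eq styp0P.

End relabelling.

Section one_block.
Variable i : 'I_K.

Let wtyp0P (m : nat) : lift ord0 i = ord0 <-> [set: nat] `<=` [set m].
Proof.
split=> [/eqP|h]; first by rewrite eq_sym (negbTE (neq_lift _ _)).
by have := h m.+1 I => /= /eqP; rewrite -addn1 -[X in _ == X]addn0 eqn_add2l.
Qed.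

Definition one_block : typed_partition K setT :=
  @TypedPartition K setT (fun=> setT) (fun=> lift ord0 i) (fun _ _ _ => I)
    (fun _ _ => I) (fun _ _ _ => erefl) (fun _ _ _ => erefl) wtyp0P.

End one_block.

Section dust.
Variable A : set nat.

Let dcls m : set nat := [set j | A m /\ j = m].

Let dcls_dom m j : dcls m j -> A m. Proof. by case. Qed.

Let dcls_refl m : A m -> dcls m m. Proof. by []. Qed.

Let dcls_eq m j : dcls m j -> dcls j = dcls m. Proof. by move=> [_ ->]. Qed.

Let dtyp0P m : ord0 = ord0 :> 'I_K.+1 <-> dcls m `<=` [set m].
Proof. by split=> // _ j []. Qed.

Definition dust : typed_partition K A :=
  @TypedPartition K A dcls (fun=> ord0) dcls_dom dcls_refl dcls_eq
    (fun _ _ _ => erefl) dtyp0P.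

End dust.

End operations.

(* The parameter R only serves to make the space a metricType R. *)
Definition tpart (R : realType) (K : nat) (A : set nat) := typed_partition K A.

HB.instance Definition _ R K A := gen_eqMixin (tpart R K A).
HB.instance Definition _ R K A := gen_choiceMixin (tpart R K A).
HB.instance Definition _ R K A := isPointed.Build (tpart R K A) (dust K A).

Section metric.
Variables (R : realType) (K : nat) (A : set nat).
Implicit Types p q r : tpart R K A.

Definition agree p q : set nat := [set n | restr `I_n p = restr `I_n q].

(* In \bar R the inverse of +oo is 0. *)
Definition tdist p q : R := fine (ereal_sup [set n%:R%:E | n in agree p q])^-1.

Let restr_restr p m n : (m <= n)%N ->
  (forall k, cls (restr `I_m (restr `I_n p)) k = cls (restr `I_m p) k) /\
  (forall k, typ (restr `I_m (restr `I_n p)) k = typ (restr `I_m p) k).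
Proof.
move=> mn; have E k : cls (restr `I_m (restr `I_n p)) k = cls (restr `I_m p) k.
  apply/seteqP; split=> j /= [km jm]; first by case.
  by move=> kj; split=> //; split=> //; exact: leq_trans mn.
split=> // k.
have [s|s] := pselect (cls (restr `I_m p) k `<=` [set k]).
  by rewrite (typ0P _ _).2 ?E// (typ0P _ _).2.
have sn : ~ cls (restr `I_n p) k `<=` [set k].
  by move=> h; apply: s => j [km jm kj]; apply: h; split=> //; exact: leq_trans mn.
have s' := s; rewrite -E in s'; move: s s' sn => /= s s' sn.
by do 3 (case: asboolP => // _).
Qed.

Let agree_le p q m n : (m <= n)%N -> agree p q n -> agree p q m.
Proof.
move=> mn; rewrite /agree/= => e.
apply: partition_ext => k.
  by rewrite -(restr_restr p mn).1 -(restr_restr q mn).1 e.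
by rewrite -(restr_restr p mn).2 -(restr_restr q mn).2 e.
Qed.

Let agree_sym p q : agree p q = agree q p.
Proof. by apply/seteqP; split=> n; rewrite /agree/= => e. Qed.

Let agree1 p q : agree p q 1%N.
Proof.
have E (r : tpart R K A) k : cls (restr `I_1 r) k = [set j | [/\ A k, k = 0%N & j = 0%N]].
  apply/seteqP; split=> j /=.
    by move=> [] /=; rewrite !ltnS !leqn0 => /eqP -> /eqP -> /cls_dom.
  by move=> [Ak k0 ->]; subst k; split=> //; exact: cls_refl.
apply: partition_ext => k; first by rewrite !E.
by rewrite !(typ0P _ _).2// E => j /= [_ -> ->].
Qed.

Let agree_all p q : (forall n, agree p q n) -> p = q.
Proof.
move=> h.
have sub (p' q' : tpart R K A) : (forall n, agree p' q' n) ->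
    forall m, cls p' m `<=` cls q' m.
  move=> h' m j mj; pose n := (maxn m j).+1.
  have : cls (restr `I_n p') m j.
    by split=> //=; rewrite ltnS ?leq_maxl ?leq_maxr.
  by rewrite (h' n) => -[].
have E m : cls p m = cls q m.
  by apply/seteqP; split; apply: sub => // n; rewrite /agree/= -h.
apply: partition_ext => // m.
have [s|s] := pselect (cls p m `<=` [set m]).
  by rewrite (typ0P p m).2// (typ0P q m).2// -E.
have [j mj jm] : exists2 j, cls p m j & j <> m.
  by apply: contrapT => H; apply: s => j mj; apply: contrapT => jm; apply: H; exists j.
pose n := (maxn m j).+1.
have T (r : tpart R K A) : cls r m j -> typ (restr `I_n r) m = typ r m.
  move=> rmj /=; case: asboolP => // H; exfalso; apply: jm; apply: H.
  by split=> //=; rewrite ltnS ?leq_maxl ?leq_maxr.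
by rewrite -(T p)// -(T q) -?E// (h n).
Qed.

Let S p q : \bar R := ereal_sup [set n%:R%:E | n in agree p q].

Let S_ge1 p q : (1 <= S p q)%E.
Proof. by apply: ereal_sup_ubound; exists 1%N => //; exact: agree1. Qed.

Let S_ultra p q r : (S p q <= S q r)%E -> (S p q <= S p r)%E.
Proof.
move=> pqr; apply: ge_ereal_sup => _ [n pqn <-].
have nqr : agree q r n.
  apply: contrapT => nqr.
  have : (n%:R%:E <= S q r)%E.
    by apply: le_trans pqr; apply: ereal_sup_ubound; exists n.
  case: n pqn nqr => [|n] pqn nqr; first by case: nqr; exact: agree_le (agree1 q r).
  apply/negP; rewrite -ltNge; apply: (@le_lt_trans _ _ n%:R%:E).
    apply: ge_ereal_sup => _ [k qrk <-]; rewrite lee_fin ler_nat leqNgt.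
    by apply/negP => nk; apply: nqr; exact: agree_le qrk.
  by rewrite lte_fin ltr_nat.
by apply: ereal_sup_ubound; exists n => //; rewrite /agree/= pqn.
Qed.

Let fineV_anti (x y : \bar R) : (1 <= x)%E -> (x <= y)%E ->
  fine y^-1 <= fine x^-1.
Proof.
case: x y => [x| |] [y| |]//.
- rewrite !lee_fin => x1 xy; rewrite !inver.
  have x0 : 0 < x by exact: lt_le_trans x1.
  have y0 : 0 < y by exact: lt_le_trans xy.
  by rewrite !gt_eqF//= lef_pV2.
- rewrite lee_fin => x1 _; have x0 : 0 < x by exact: lt_le_trans x1.
  by rewrite invey inver gt_eqF//= invr_ge0 ltW.
Qed.

Let tdistxx p : tdist p p = 0.
Proof.
suff -> : tdist p p = fine (+oo : \bar R)^-1%E by rewrite invey.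
rewrite /tdist; congr (fine _^-1%E); apply/eqyP => r r0.
apply: (@le_trans _ _ (Num.truncn r).+1%:R%:E).
  by rewrite lee_fin ltW// truncnS_gt.
by apply: ereal_sup_ubound; exists (Num.truncn r).+1.
Qed.

Let tdist_sym p q : tdist p q = tdist q p.
Proof.
by rewrite /tdist agree_sym.
Qed.

Let tdist_ge0 p q : 0 <= tdist p q.
Proof.
have := S_ge1 p q; rewrite /tdist -/(S p q).
case: (S p q) => [x| |]//.
rewrite lee_fin => x1; have x0 : 0 < x by exact: lt_le_trans x1.
by rewrite inver gt_eqF//= invr_ge0 ltW.
Qed.

Let tdist_positivity p q : tdist p q = 0 -> p = q.
Proof.
have := S_ge1 p q; rewrite /tdist -/(S p q).
case E : (S p q) => [x| |]//.
  rewrite lee_fin => x1; have x0 : 0 < x by exact: lt_le_trans x1.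
  by rewrite inver gt_eqF//= => /eqP; rewrite invr_eq0 gt_eqF.
move=> _ _; apply: agree_all => n; apply: contrapT => npq.
suff : (S p q <= n%:R%:E)%E by rewrite E.
apply: ge_ereal_sup => _ [k pqk <-]; rewrite lee_fin ler_nat leqNgt.
by apply/negP => nk; apply: npq; exact: agree_le (ltnW nk) pqk.
Qed.

Let tdist_triangle q p r : tdist p r <= tdist p q + tdist q r.
Proof.
have [h|/ltW h] := leP (S p q) (S q r).
  have := fineV_anti (S_ge1 p q) (S_ultra h); rewrite -/(tdist p r) -/(tdist p q).
  by move=> /le_trans; apply; rewrite lerDl.
have sym a b : S a b = S b a.
  by rewrite /S agree_sym.
have h' : (S r q <= S q p)%E by rewrite (sym r q) (sym q p).
have := fineV_anti (S_ge1 _ _) (S_ultra h').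
rewrite -/(tdist r p) -/(tdist r q) tdist_sym (tdist_sym r q).
by move=> /le_trans; apply; rewrite lerDr.
Qed.

HB.instance Definition _ := isMetric.Build R (tpart R K A)
  tdistxx tdist_positivity tdist_sym tdist_triangle.

End metric.

Section frequencies.
Variable R : realType.

Definition density (B : set nat) (n : nat) : R :=
  #|[pred k : 'I_n | `[< B k >]]|%:R / n%:R.

Definition has_freq (B : set nat) : Prop := cvgn (density B).

(* The asymptotic frequency |B|, meaningful when has_freq B. *)
Definition freq (B : set nat) : R := limn (density B).

End frequencies.

Section processes.
Variables (R : realType) (K : nat).

Definition borel (A : set nat) : set (set (tpart R K A)) := <<s open >>.

(* Laws of processes indexed by t >= 0 are compared on the sigma-algebra
   generated by the coordinates; the values at negative times play no role. *)
Definition path_measurable (A : set nat) : set (set (R -> tpart R K A)) :=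
  <<s [set C | exists (t : R) B, [/\ 0 <= t, borel B & C = [set f | B (f t)]]] >>.

Definition cadlag (A : set nat) (f : R -> tpart R K A) : Prop :=
  (forall t : R, 0 <= t -> f @ t^'+ --> f t) /\
  (forall t : R, 0 < t -> cvg (f @ t^'-)).

Variables (d : measure_display) (Omega : measurableType d).

Definition same_law (A : set nat)
    (P : probability Omega R) (Y : R -> Omega -> tpart R K A)
    (Q : probability Omega R) (Z : R -> Omega -> tpart R K A) : Prop :=
  forall C, path_measurable C ->
    P [set w | C (Y ^~ w)] = Q [set w | C (Z ^~ w)].

Definition independent_processes (P : probability Omega R)
    (A : nat -> set nat) (Y : forall n, R -> Omega -> tpart R K (A n)) : Prop :=
  forall (J : {fset nat}) (C : forall n, set (R -> tpart R K (A n))),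
    (forall n, n \in J -> path_measurable (C n)) ->
    P (\bigcap_(n in [set` J]) [set w | C n (Y n ^~ w)]) =
    (\prod_(n <- J) P [set w | C n (Y n ^~ w)])%E.

Definition restr_process (B : set nat) (X : R -> Omega -> tpart R K setT) :
  R -> Omega -> tpart R K (setT `&` B) := fun t w => restr B (X t w).

Definition relabel_process (s : nat -> nat) (sB : bijective s)
    (X : R -> Omega -> tpart R K setT) : R -> Omega -> tpart R K setT :=
  fun t w => relabel sB (X t w).

(* The sigma-algebra generated by (X r), 0 <= r <= s. *)
Definition history (X : R -> Omega -> tpart R K setT) (s : R) :
    set (set Omega) :=
  <<s [set E | exists (r : R) B, [/\ 0 <= r <= s, borel B & E = X r @^-1` B]] >>.

(* A process X on Omega with the law P p when started from p. *)
Record markov_process (P : tpart R K setT -> probability Omega R)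
    (X : R -> Omega -> tpart R K setT) : Prop := MarkovProcess {
  markov_measurable : forall (t : R) B, 0 <= t -> borel B -> measurable (X t @^-1` B) ;
  markov_start : forall p, {ae P p, forall w, X 0 w = p} ;
  markov_kernel : forall (t : R) B, 0 <= t -> borel B ->
    measurable_fun setT ((fun p => P p (X t @^-1` B)) :
      g_sigma_algebraType (@open (tpart R K setT)) -> \bar R) ;
  markov_property : forall p (s t : R) E B, 0 <= s -> 0 <= t ->
    history X s E -> borel B ->
    P p (E `&` X (s + t) @^-1` B) =
    (\int[P p]_(w in E) P (X s w) (X t @^-1` B))%E }.

Definition all_freq (p : tpart R K setT) : Prop :=
  forall m, has_freq R (cls p m).

(* For p without asymptotic frequencies, neither the frequencies of the process
   started from p nor the time changes |p_n|^alpha make sense; likewise a block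
   of null frequency has no time change |p_n|^alpha when alpha < 0, and the
   restriction of the process to an empty or singleton block is constant.  The
   clause fragments expresses that the processes X t `&` p_n are the pieces
   whose union is X t. *)
Record self_similar_fragmentation (alpha : R)
    (P : tpart R K setT -> probability Omega R)
    (X : R -> Omega -> tpart R K setT) : Prop := SelfSimilarFragmentation {
  fragmentation_markov : markov_process P X ;
  fragmentation_cadlag : forall w, cadlag (X ^~ w) ;
  fragmentation_freq : forall p, all_freq p ->
    {ae P p, forall w, forall m,
      (forall t : R, 0 <= t -> has_freq R (cls (X t w) m)) /\
      (forall t : R, 0 <= t ->
        (fun u => freq R (cls (X u w) m)) @ t^'+ --> freq R (cls (X t w) m))} ;
  fragmentation_exchangeable : forall (i : 'I_K) s (sB : bijective s),
    same_law (P (one_block i)) (relabel_process sB X) (P (one_block i)) X ;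
  fragmentation_fragments : forall p, all_freq p ->
    {ae P p, forall w, forall t : R, 0 <= t ->
      forall m, cls (X t w) m `<=` cls p m} ;
  fragmentation_independent : forall p, all_freq p ->
    independent_processes (P p) (fun n => restr_process (block p n) X) ;
  fragmentation_law : forall p, all_freq p -> forall n (i : 'I_K),
    btype p n = lift ord0 i -> 0 < freq R (block p n) ->
    same_law (P p) (restr_process (block p n) X)
      (P (one_block i))
      (restr_process (block p n)
        (fun t => X (freq R (block p n) `^ alpha * t))) }.

(* Whatever the initial type, the untyped partition is not a.s. constant. *)
Definition nonconstant_partition (P : tpart R K setT -> probability Omega R)
    (X : R -> Omega -> tpart R K setT) : Prop :=
  forall i : 'I_K, ~ {ae P (one_block i), forall w,
    forall t : R, 0 <= t -> cls (X t w) = cls (X 0 w)}.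

(* The infimum is +oo when the set of times is empty. *)
Definition zeta (X : R -> Omega -> tpart R K setT) (w : Omega) : \bar R :=
  ereal_inf [set t%:E | t in
    [set t | 0 <= t /\ forall m, cls (X t w) m = [set m]]].

End processes.

(* Main.v *)
Require Import Defs.
From mathcomp Require Import all_boot all_order all_algebra.
From mathcomp Require Import all_classical all_reals all_analysis.
From mathcomp Require Import measurable_realfun.
From mathcomp Require Import lra ring.

Set Implicit Arguments.
Unset Strict Implicit.
Unset Printing Implicit Defensive.

Import Order.TTheory GRing.Theory Num.Theory.
Import numFieldNormedType.Exports.

Local Open Scope classical_set_scope.
Local Open Scope ring_scope.

(** The extinction time is controlled through its tail along an arithmetic
   progression of times: if the probability that X (a n + b) is not reduced to
   singletons is at most 4 q^n with q < 1, then zeta is finite almost surely and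
   exp (c zeta) is dominated by a series with finite integral once
   exp (c a) q < 1 (exponential_moment). Only laws at fixed times are needed.

   The process is followed through the events big z, that some block has lower
   density above z. Exchangeability makes the links with the partition itself:
   a block other than a singleton has positive frequency (dust_big), a block
   other than the whole of nat has frequency less than 1 (cut_small), and the
   trace of the process on an infinite set, read along the enumeration of that
   set, has the law of the process (exchange_inj). The first two are a mean
   value argument (null_mean): given m, all j other than m are equally likely to
   be in the block of m.

   With the last fact, self-similarity and the Markov property give the
   branching estimate branch_step. If all blocks have frequency at most y at
   time s, at most N of them have frequency above th y, with (N + 1) th y >= 1;
   as alpha < 0, the clock of each of these runs at least y^alpha times faster
   than that of the initial block, so within a further time y^-alpha t each of
   them keeps a fragment above th y with probability at most q, a bound, over
   the finitely many types, of the probability of big th at time t.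

   The estimate is used three times. From the fact that the partition moves with
   positive probability, whatever the type, one gets by iteration with N = 1 a
   time at which all blocks are below 1/2 with positive probability
   (big_le_prob_half). Since at most one block is above 1/2, trying again at each
   multiple of this time gives a geometric tail (big_le_prob_geometric). Finally,
   passing from level 2^-k to level 2^-(k+1) concerns at most 2^(k+1) blocks,
   which take a time shorter by the factor 2^(alpha k); the levels can thus be
   given times with a finite sum, proportional to n up to a constant, but long
   enough for the failure probabilities at all levels to add up to a multiple of
   q^n (nondust_geometric). *)

(** * Counting and lower densities *)

Section counting.
Implicit Types (B C D : set nat) (n k : nat).

Definition cnt B n : nat := \sum_(k < n) `[< B k >].

Lemma cnt0 B : cnt B 0 = 0%N.
Proof. by rewrite /cnt big_ord0. Qed.

Lemma cntS B n : cnt B n.+1 = (cnt B n + `[< B n >])%N.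
Proof. by rewrite /cnt big_ord_recr. Qed.

Lemma cnt_le B n : (cnt B n <= n)%N.
Proof.
elim: n => [|n IH]; first by rewrite cnt0.
by rewrite cntS -addn1 leq_add// leq_b1.
Qed.

Lemma cnt_mono B n k : (n <= k)%N -> (cnt B n <= cnt B k)%N.
Proof.
elim: k => [|k IH]; first by rewrite leqn0 => /eqP->.
rewrite leq_eqVlt => /orP[/eqP->//|]; rewrite ltnS => /IH h.
by rewrite cntS (leq_trans h)// leq_addr.
Qed.

Lemma subset_cnt B C n : B `<=` C -> (cnt B n <= cnt C n)%N.
Proof.
move=> BC; apply: leq_sum => k _.
by case: asboolP => // /BC Ck; case: asboolP.
Qed.

Lemma cnt_setC B n : (cnt B n + cnt (~` B) n)%N = n.
Proof.
rewrite /cnt -big_split/= -[RHS]card_ord -sum1_card; apply: eq_bigr => k _.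
by case: asboolP => Bk; case: asboolP.
Qed.

Lemma cnt_disjoint (L : seq nat) (c : nat -> set nat) n :
  (forall k i j, i \in L -> j \in L -> c i k -> c j k -> i = j) -> uniq L ->
  (\sum_(i <- L) cnt (c i) n <= n)%N.
Proof.
move=> dis uL; rewrite /cnt exchange_big/= -[leqRHS]card_ord -sum1_card.
apply: leq_sum => k _; elim: L dis uL => [|a L IH] dis; first by rewrite big_nil.
move=> /= /andP[aL uL]; rewrite big_cons; case: asboolP => ak /=; last first.
  rewrite add0n; apply: IH => // i j j' iL jL; apply: dis; by rewrite in_cons ?iL ?jL orbT.
rewrite big1_seq// => i /andP[_ iL]; case: asboolP => // ik.
have ia : i = a by apply: dis ik ak; rewrite in_cons ?eqxx ?iL ?orbT.
by move: aL; rewrite -ia iL.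
Qed.

Definition swap (a b : nat) : nat -> nat :=
  fun k => if k == a then b else if k == b then a else k.

Lemma swapK a b : involutive (swap a b).
Proof.
move=> k; rewrite /swap; case: (eqVneq k a) => [->|ka].
  by case: (eqVneq b a) => [->|]; rewrite ?eqxx.
by case: (eqVneq k b) => [->|kb]; rewrite ?eqxx // (negbTE ka) (negbTE kb).
Qed.

Lemma swap_bij a b : bijective (swap a b).
Proof. exact: inv_bij (@swapK a b). Qed.

Lemma swapL a b : swap a b a = b. Proof. by rewrite /swap eqxx. Qed.
Lemma swapD a b k : k != a -> k != b -> swap a b k = k.
Proof. by rewrite /swap => /negbTE -> /negbTE ->. Qed.

Lemma cnt_swap a b B n : (cnt (swap a b @^-1` B) n <= cnt B n + 2)%N.
Proof.
have point c : (\sum_(k < n) (k == c :> nat) <= 1)%N.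
  elim: n => [|m IH]; first by rewrite big_ord0.
  rewrite big_ord_recr /=; case: eqP => [->|_]; last by rewrite addn0.
  rewrite addn1 ltnS leqn0 big1// => i _.
  by rewrite (ltn_eqF (ltn_ord i)).
apply: (@leq_trans (\sum_(k < n) (`[< B k >] + ((k == a :> nat) + (k == b :> nat))))%N).
  apply: leq_sum => k _.
  case: (eqVneq (k : nat) a) => [->|ka]; first by rewrite addnCA (leq_trans (leq_b1 _))// leq_addr.
  case: (eqVneq (k : nat) b) => [->|kb]; first by rewrite addnC (leq_trans (leq_b1 _))// leq_addr.
  by rewrite /preimage/= swapD ?addn0.
by rewrite big_split/= leq_add2l big_split/= -[2%N]/(1 + 1)%N leq_add.
Qed.

(** The increasing enumeration of an infinite set, through its counting
   function: the k-th element is the first n with k + 1 elements up to n. *)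
Lemma enumerate B : (forall k, exists n, (k < cnt B n)%N) ->
  exists phi : nat -> nat, [/\ injective phi, forall k, B (phi k),
    forall b, B b -> phi (cnt B b) = b & forall k, cnt B (phi k) = k].
Proof.
move=> inf.
have inf' k : exists n, (k < cnt B n.+1)%N.
  by have [[|n] kn] := inf k; [rewrite cnt0 in kn|exists n].
pose phi k := ex_minn (inf' k).
have cphi k : cnt B (phi k) = k /\ B (phi k).
  rewrite /phi; case: ex_minnP => n kn nmin.
  have nk : (cnt B n <= k)%N.
    case: n kn nmin => [|n] kn nmin; first by rewrite cnt0.
    by rewrite leqNgt; apply/negP => /nmin; rewrite ltnn.
  move: kn; rewrite cntS; case: asboolP => [Bn|_].
    by rewrite addn1 ltnS => h; split=> //; apply/eqP; rewrite eqn_leq nk h.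
  by rewrite addn0 ltnNge nk.
exists phi; split=> [j k e|k|b Bb|k].
- by rewrite -(cphi j).1 e (cphi k).1.
- exact: (cphi k).2.
- rewrite /phi; case: ex_minnP => n bn nmin; apply/eqP; rewrite eqn_leq.
  rewrite nmin/=; last by rewrite cntS asboolT// addn1.
  rewrite leqNgt; apply/negP => nb; have := leq_trans bn (cnt_mono B nb).
  by rewrite ltnn.
- exact: (cphi k).1.
Qed.

Lemma cnt_enumerate B C (phi : nat -> nat) n : C `<=` B ->
  (forall b, B b -> phi (cnt B b) = b) ->
  cnt C n = cnt (phi @^-1` C) (cnt B n).
Proof.
move=> CB phiB; elim: n => [|n IH]; first by rewrite !cnt0.
rewrite !cntS IH; case: (asboolP (B n)) => Bn /=.
  by rewrite addn1 cntS /preimage/= phiB.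
by rewrite addn0; case: asboolP => [/CB//|]; rewrite addn0.
Qed.

(** At each step, a transposition corrects the value at n without changing the
   values before n. *)
Lemma inj_extend (phi : nat -> nat) n : injective phi ->
  exists2 s : nat -> nat, bijective s & forall k, (k < n)%N -> s k = phi k.
Proof.
move=> phiI; elim: n => [|n [s sB sE]]; first by exists id => //; exists id.
exists (swap (s n) (phi n) \o s).
  exact: bij_comp (swap_bij _ _) sB.
move=> k; rewrite ltnS leq_eqVlt => /orP[/eqP->/=|kn /=]; first by rewrite swapL.
rewrite swapD ?(sE k kn)//; apply/eqP => h.
- have e : k = n by apply: (bij_inj sB); rewrite (sE k kn).
  by rewrite e ltnn in kn.
- by rewrite (phiI _ _ h) ltnn in kn.
Qed.

End counting.

Section lower_density.
Variable R : realType.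
Implicit Types (B C D : set nat) (z x : R).

Lemma densityE B n : density R B n = (cnt B n)%:R / n%:R.
Proof.
by rewrite /density /cnt -sum1_card big_mkcond.
Qed.

Lemma density_ge0 B n : 0 <= density R B n.
Proof. by rewrite densityE divr_ge0. Qed.

Lemma density_le1 B n : density R B n <= 1.
Proof.
case: n => [|n]; first by rewrite densityE invr0 mulr0.
by rewrite densityE ler_pdivrMr ?ltr0n// mul1r ler_nat cnt_le.
Qed.

Lemma subset_density B C n : B `<=` C -> density R B n <= density R C n.
Proof. by move=> BC; rewrite !densityE ler_wpM2r ?invr_ge0// ler_nat subset_cnt. Qed.

Lemma density_setC B n : (0 < n)%N -> density R (~` B) n = 1 - density R B n.
Proof.
move=> n0; apply/eqP; rewrite eq_sym subr_eq eq_sym !densityE -mulrDl -natrD addnC.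
by rewrite cnt_setC divff// pnatr_eq0 -lt0n.
Qed.

(** That z is less than the lower density of B. Being written with countable
   quantifiers it defines events, and it makes sense for sets that have no
   asymptotic frequency. *)
Definition exceeds z B : Prop := exists k N : nat,
  forall n, (N <= n)%N -> z + k.+1%:R^-1 <= density R B n.

Definition null B : Prop := forall k : nat, exists N : nat,
  forall n, (N <= n)%N -> density R B n <= k.+1%:R^-1.

Lemma inv_ltP (e : R) : 0 < e -> exists k : nat, k.+1%:R^-1 < e.
Proof.
move=> e0; exists (Num.truncn e^-1).
by rewrite invf_plt ?posrE ?ltr0n// truncnS_gt.
Qed.

Lemma exceedsP z B : exceeds z B <-> exists2 e : R, 0 < e &
  exists N, forall n, (N <= n)%N -> z + e <= density R B n.
Proof.
split=> [[k [N h]]|[e e0 [N h]]]; first by exists k.+1%:R^-1 => //; exists N.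
have [k ke] := inv_ltP e0; exists k, N => n /h; apply: le_trans.
by rewrite lerD2l ltW.
Qed.

Lemma exceeds_le z x B C : z <= x -> B `<=` C -> exceeds x B -> exceeds z C.
Proof.
move=> zx BC [k [N h]]; exists k, N => n /h xB.
by rewrite (le_trans _ (subset_density n BC))// (le_trans _ xB)// lerD2r.
Qed.

Lemma exceeds_lt1 z B : exceeds z B -> z < 1.
Proof.
move=> /exceedsP[e e0 [N /(_ _ (leqnn N)) h]].
by have := le_trans h (density_le1 B N); lra.
Qed.

Lemma freq_cvg B : has_freq R B -> density R B n @[n --> \oo] --> freq R B.
Proof. by []. Qed.

Lemma exceeds_freq z B : has_freq R B -> exceeds z B <-> z < freq R B.
Proof.
move=> /freq_cvg cB; split=> [/exceedsP[e e0 [N h]]|zB].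
  apply: (@lt_le_trans _ _ (z + e)); first by lra.
  by apply: (cvgr_to_ge cB); exists N.
apply/exceedsP; exists ((freq R B - z) / 2); first by lra.
have : z + (freq R B - z) / 2 < freq R B by lra.
move=> /(cvgr_ge _ cB) [N _ h]; by exists N.
Qed.

Lemma nullP B : null B <-> density R B n @[n --> \oo] --> (0 : R).
Proof.
split=> [nB|cB k].
  apply/cvgrPdist_le => e e0; have [k ke] := inv_ltP e0.
  have [N h] := nB k; exists N => // n /= /h hn.
  by rewrite sub0r normrN ger0_norm ?density_ge0// (le_trans hn)// ltW.
have : 0 < k.+1%:R^-1 :> R by rewrite invr_gt0.
by move=> /(cvgr_le _ cB)[N _ h]; exists N.
Qed.

Lemma not_exceeds_null B : has_freq R B -> ~ exceeds 0 B -> null B.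
Proof.
move=> fB /(exceeds_freq 0 fB) /negP; rewrite -leNgt => f0.
apply/nullP; suff <- : freq R B = 0 by exact: freq_cvg.
apply/eqP; rewrite eq_le f0/=; apply: (cvgr_to_ge (freq_cvg fB)).
by near=> n; exact: density_ge0.
Unshelve. all: by end_near. Qed.

Lemma exceeds_null_setC B : (forall k : nat, exceeds (1 - k.+1%:R^-1) B) ->
  null (~` B).
Proof.
move=> h k; have [j [N hN]] := h k; exists N.+1 => n Nn.
rewrite density_setC ?(leq_ltn_trans _ Nn)//.
rewrite lerBlDr -lerBlDl (le_trans _ (hN n (ltnW Nn)))//.
by rewrite lerDl invr_ge0.
Qed.

Lemma null_swap a b B : null B -> null (swap a b @^-1` B).
Proof.
move=> /nullP cB; apply/nullP.
apply: (@squeeze_cvgr _ _ _ _ (fun=> 0) (fun n => density R B n + 2 * n%:R^-1)).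
- near=> n; rewrite density_ge0/= !densityE -mulrDl ler_wpM2r ?invr_ge0//.
  by rewrite -natrD ler_nat cnt_swap.
- exact: cvg_cst.
- rewrite -[X in _ --> X](addr0 0); apply: cvgD => //.
  rewrite -[X in _ --> X](mulr0 2); apply: cvgMr.
  apply/cvgrPdist_le => e e0; have [k ke] := inv_ltP e0.
  exists k.+1 => // n /= kn; rewrite sub0r normrN ger0_norm ?invr_ge0//.
  by rewrite (le_trans _ (ltW ke))// lef_pV2 ?posrE ?ltr0n ?ler_nat// (leq_trans _ kn).
Unshelve. all: by end_near. Qed.

(** The densities of disjoint sets add up to at most 1. *)
Lemma exceeds_disjoint (L : seq nat) (c : nat -> set nat) z :
  (forall k i j, i \in L -> j \in L -> c i k -> c j k -> i = j) -> uniq L ->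
  (forall i, i \in L -> exceeds z (c i)) -> 1 <= (size L)%:R * z -> False.
Proof.
move=> dis uL exL L1.
have [e e0 [N h]] : exists2 e : R, 0 < e & exists N, forall n, (N <= n)%N ->
    forall i, i \in L -> z + e <= density R (c i) n.
  elim: L exL {dis uL L1} => [|a L IH] exL; first by exists 1 => //; exists 0%N.
  have [i iL|e e0 [N h]] := IH; first by apply: exL; rewrite in_cons iL orbT.
  have /exceedsP[e' e'0 [N' h']] := exL a (mem_head _ _).
  exists (Num.min e e'); first by rewrite lt_min e0.
  exists (maxn N N') => n; rewrite geq_max => /andP[Nn N'n] i.
  rewrite in_cons => /predU1P[->|iL].
    by rewrite (le_trans _ (h' n N'n))// lerD2l ge_min lexx orbT.
  by rewrite (le_trans _ (h n Nn i iL))// lerD2l ge_min lexx.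
have L0 : (0 < size L)%N.
  by case: L L1 {dis uL exL h} => //=; rewrite mul0r; lra.
have : (size L)%:R * (z + e) <= \sum_(i <- L) density R (c i) N.+1.
  have -> : (size L)%:R * (z + e) = \sum_(i <- L) (z + e).
    by rewrite big_const_seq count_predT iter_addr_0 mulr_natl.
  by rewrite big_seq [leRHS]big_seq; apply: ler_sum => i; exact: h.
under eq_bigr do rewrite densityE; rewrite -mulr_suml -natr_sum.
have : (\sum_(i <- L) cnt (c i) N.+1)%:R / N.+1%:R <= 1 :> R.
  by rewrite ler_pdivrMr ?ltr0n// mul1r ler_nat cnt_disjoint.
have Le0 : 0 < (size L)%:R * e :> R by rewrite mulr_gt0 ?ltr0n.
move=> /[swap] /le_trans /[apply]; rewrite mulrDr leNgt => /negP; apply.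
by rewrite (le_lt_trans L1)// ltrDl.
Qed.

Lemma exceeds_infinite z B : 0 <= z -> exceeds z B ->
  forall k, exists n, (k < cnt B n)%N.
Proof.
move=> z0 /exceedsP[e e0 [N h]] k.
have [M Me] : exists M : nat, k%:R < M%:R * e.
  exists (Num.truncn (k%:R / e)).+1.
  by rewrite -ltr_pdivrMr// truncnS_gt.
pose n := (maxn N M).+1; exists n; rewrite -(ltr_nat R).
have := h n; rewrite densityE ler_pdivlMr ?ltr0n// => hn.
have {hn} hn : (z + e) * n%:R <= (cnt B n)%:R by apply: hn; rewrite ltnW// ltnS leq_maxl.
apply: (lt_le_trans Me); apply: le_trans hn; rewrite mulrC; apply: ler_pM => //.
- exact: ltW.
- by rewrite lerDr.
- by rewrite ler_nat ltnW// ltnS leq_maxr.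
Qed.

(** The integers up to phi k contain k points of B, so k / phi k tends to x: read
   along the enumeration phi of B, densities of subsets of B are divided by x. *)
Lemma exceeds_enumerate B C (phi : nat -> nat) th z x :
  0 <= th -> C `<=` B -> has_freq R B -> freq R B = x ->
  (forall k, exists n, (k < cnt B n)%N) ->
  (forall b, B b -> phi (cnt B b) = b) -> (forall k, cnt B (phi k) = k) ->
  (forall k, B (phi k)) ->
  th * x <= z -> exceeds z C -> exceeds th (phi @^-1` C).
Proof.
move=> th0 CB fB Bx inf phiB cphi Bphi thxz /exceedsP[e e0 [N hN]].
have phi_ge k : (k <= phi k)%N by rewrite -{1}(cphi k) cnt_le.
have [x0 x1] : 0 <= x /\ x <= 1.
  split; rewrite -Bx.
    by apply: (cvgr_to_ge (freq_cvg fB)); near=> n; exact: density_ge0.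
  by apply: (cvgr_to_le (freq_cvg fB)); near=> n; exact: density_le1.
pose e1 := e / (2 * (th + 1)).
have e10 : 0 < e1 by rewrite divr_gt0//; lra.
have e1E : e1 * (th + 1) = e / 2 by rewrite /e1; field; apply: lt0r_neq0; lra.
have xe1 : freq R B < x + e1 by rewrite Bx; lra.
have [M _ hM] := cvgr_le _ (freq_cvg fB) _ xe1.
pose e2 := e / (2 * (x + e1)).
have e20 : 0 < e2 by rewrite divr_gt0//; lra.
have e2E : e2 * (x + e1) = e / 2 by rewrite /e2; field; apply: lt0r_neq0; lra.
apply/exceedsP; exists e2 => //; exists (maxn N M).+1 => k kNM.
have k0 : (0 < k)%N by rewrite (leq_ltn_trans _ kNM).
have [Nk Mk] : (N <= phi k)%N /\ (M <= phi k)%N.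
  by apply/andP; rewrite -geq_max (leq_trans _ (phi_ge k))// ltnW.
have p0 : (0 < phi k)%N by rewrite (leq_trans k0).
have := hN _ Nk; have := hM _ Mk; rewrite /= !densityE.
rewrite (cnt_enumerate (B := B) (phi := phi) (phi k) CB)// !cphi.
rewrite !(ler_pdivrMr, ler_pdivlMr) ?ltr0n//.
set c : R := (cnt _ k)%:R => h1 h2; apply: le_trans h2.
have P0 : 0 < (phi k)%:R :> R by rewrite ltr0n.
apply: (@le_trans _ _ ((th + e2) * ((x + e1) * (phi k)%:R))).
  by rewrite ler_wpM2l//; lra.
rewrite mulrA ler_wpM2r//.
have -> : (th + e2) * (x + e1) = th * x + th * e1 + e2 * (x + e1) by ring.
rewrite e2E; have : th * e1 <= e / 2 by rewrite -e1E mulrC mulrDr; lra.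
lra.
Unshelve. all: by end_near. Qed.

End lower_density.

(** * Measurable events of partitions *)

Section measurable_densities.
Context d (T : measurableType d) (R : realType).
Variable B : T -> set nat.
Hypothesis mB : forall j, measurable [set t | B t j].

Let mdensity n : measurable_fun setT (fun t => density R (B t) n).
Proof.
have -> : (fun t => density R (B t) n) =
    (fun t => (\sum_(k < n) \1_[set t | B t k] t) * n%:R^-1).
  apply/funext => t; rewrite densityE; congr (_ * _).
  rewrite /cnt natr_sum; apply: eq_bigr => k _.
  by rewrite indicE; congr (_%:R); congr nat_of_bool; rewrite in_setE.
apply: measurable_funM => //.
by apply: measurable_sum => k; exact: measurable_indic.
Qed.

Lemma measurable_exceeds (z : R) : measurable [set t | exceeds z (B t)].
Proof.
have -> : [set t | exceeds z (B t)] = \bigcup_k \bigcup_N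
    \bigcap_(n in [set n | (N <= n)%N])
      [set t | z + k.+1%:R^-1 <= density R (B t) n].
  apply/seteqP; split=> [t [k [N h]]|t [k _ [N _ h]]].
    by exists k => //; exists N => // n Nn; exact: h.
  by exists k, N => n Nn; exact: h.
apply: bigcupT_measurable => k; apply: bigcupT_measurable => N.
apply: bigcap_measurable => [|n _]; first by exists N => /=.
by rewrite -[X in measurable X]setTI; exact: measurable_fun_le.
Qed.

Lemma measurable_null : measurable [set t | null R (B t)].
Proof.
have -> : [set t | null R (B t)] = \bigcap_k \bigcup_N
    \bigcap_(n in [set n | (N <= n)%N])
      [set t | density R (B t) n <= k.+1%:R^-1].
  apply/seteqP; split=> [t h k _|t h k].
    by have [N hN] := h k; exists N => // n Nn; exact: hN.
  by have [N _ hN] := h k I; exists N => n Nn; exact: hN.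
apply: bigcapT_measurable => k; apply: bigcupT_measurable => N.
apply: bigcap_measurable => [|n _]; first by exists N => /=.
by rewrite -[X in measurable X]setTI; exact: measurable_fun_le.
Qed.

End measurable_densities.

Notation array := (nat -> set nat).

(** Finite sets of pairs instead of single pairs make this generating family of
   events closed under intersection, as the pi-lambda theorem requires. *)
Definition cylinder : set (set array) :=
  [set E | exists s : seq (nat * nat),
    E = [set c | forall x, x \in s -> c x.1 x.2]].

Notation arrayType := (g_sigma_algebraType cylinder).

(** Lower densities keep the event meaningful for all arrays, in particular for
   the traces of partitions on a subset of nat. *)
Definition big (R : realType) (z : R) : set array :=
  [set c | exists m, exceeds z (c m)].

Section arrays.
Variable R : realType.
Implicit Types (E : set array) (z : R).

Lemma cylinderI : setI_closed cylinder.
Proof.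
move=> _ _ [s ->] [t ->]; exists (s ++ t); apply/seteqP; split=> c.
  by move=> [cs ct] x; rewrite mem_cat => /orP[/cs|/ct].
by move=> cst; split=> x xs; apply: cst; rewrite mem_cat xs ?orbT.
Qed.

Lemma array_entry m j : measurable ([set c | c m j] : set arrayType).
Proof.
apply: sub_sigma_algebra; exists [:: (m, j)]; apply/seteqP; split=> c /=.
  by move=> cmj x; rewrite inE => /eqP ->.
by move=> /(_ (m, j)); apply; rewrite inE.
Qed.

Lemma array_preimage d (T : measurableType d) (c : T -> array) :
  (forall m j, measurable [set t | c t m j]) ->
  forall E, measurable (E : set arrayType) -> measurable (c @^-1` E).
Proof.
move=> mc E mE; rewrite -[X in measurable X]setTI.
suff mf : measurable_fun setT (c : T -> arrayType) by exact: mf.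
apply: (@measurability _ _ _ arrayType _ _ cylinder) => //.
move=> _ [_ [s ->] <-]; rewrite setTI.
elim: s => [|x s IH].
  rewrite (_ : c @^-1` _ = setT)//.
  by apply/seteqP; split=> t // _ x; rewrite in_nil.
rewrite (_ : c @^-1` _ = [set t | c t x.1 x.2] `&`
    c @^-1` [set c | forall y, y \in s -> c y.1 y.2]).
  exact: measurableI.
apply/seteqP; split=> t /=.
  by move=> h; split=> [|y ys]; apply: h; rewrite inE ?eqxx ?ys ?orbT.
by move=> [tx ts] y; rewrite inE => /predU1P[->//|/ts].
Qed.

Lemma array_big z : measurable (big z : set arrayType).
Proof.
have -> : big z = \bigcup_m [set c : array | exceeds z (c m)].
  by apply/seteqP; split=> c [m h]; [exists m|move=> ?; exists m].
apply: bigcupT_measurable => m; apply: (measurable_exceeds (T := arrayType)).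
exact: array_entry.
Qed.

Lemma big_le z z' : z <= z' -> big z' `<=` big z.
Proof. by move=> zz c [m h]; exists m; exact: (exceeds_le zz (@subset_refl _ _) h). Qed.

Lemma big_sub z (c c' : array) : (forall m, c m `<=` c' m) -> big z c -> big z c'.
Proof. by move=> cc [m h]; exists m; exact: (exceeds_le (lexx _) (cc m) h). Qed.

Lemma bigN1 c : ~ big (1 : R) c.
Proof. by move=> [m /exceeds_lt1]; rewrite ltxx. Qed.

End arrays.

Section borel_entries.
Variables (R : realType) (K : nat) (A : set nat).
Implicit Types p q : tpart R K A.

Let agree1 p q : agree p q 1%N.
Proof.
have E (r : tpart R K A) k :
    cls (restr `I_1 r) k = [set j | [/\ A k, k = 0%N & j = 0%N]].
  apply/seteqP; split=> j /=.
    by move=> [] /=; rewrite !ltnS !leqn0 => /eqP -> /eqP -> /cls_dom.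
  by move=> [Ak k0 ->]; subst k; split=> //; exact: cls_refl.
apply: partition_ext => k; first by rewrite !E.
by rewrite !(typ0P _ _).2// E => j /= [_ -> ->].
Qed.

(** Partitions at a small distance have the same trace on {0, ..., n}. *)
Lemma tdist_entry m j : exists2 e : R, 0 < e &
  forall p q, tdist p q < e -> cls p m j -> cls q m j.
Proof.
pose n := (maxn m j).+1.
exists n%:R^-1; first by rewrite invr_gt0.
move=> p q; rewrite ltNge => /negP + pmj; apply: contra_notP => qmj.
have bound k : agree p q k -> (k <= n)%N.
  move=> pqk; rewrite leqNgt; apply/negP => nk; apply: qmj.
  have [mk jk] : (m < k)%N /\ (j < k)%N.
    by split; rewrite (leq_trans _ nk)// ltnS ltnW// ltnS ?leq_maxl ?leq_maxr.
  have : cls (restr `I_k p) m j by [].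
  by rewrite pqk => -[].
rewrite /tdist; set S := ereal_sup _.
have S1 : (1 <= S)%E by apply: ereal_sup_ubound; exists 1%N => //; exact: agree1.
have Sn : (S <= n%:R%:E)%E.
  by apply: ge_ereal_sup => _ [k /bound kn <-]; rewrite lee_fin ler_nat.
move: S S1 Sn => [s| |]//; rewrite !lee_fin => s1 sn.
have s0 : 0 < s by rewrite (lt_le_trans _ s1).
by rewrite inver gt_eqF//= lef_pV2 ?posrE ?ltr0n.
Qed.

Lemma open_entry m j : open [set p : tpart R K A | cls p m j].
Proof.
have [e e0 h] := tdist_entry m j; rewrite openE => p pmj.
rewrite /interior -nbhs_ballE; exists e => // q.
by rewrite ballEmdist => pq; exact: h pq pmj.
Qed.

Lemma open_entryC m j : open [set p : tpart R K A | ~ cls p m j].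
Proof.
have [e e0 h] := tdist_entry m j; rewrite openE => p pmj.
rewrite /interior -nbhs_ballE; exists e => // q.
move=> /ball_sym; rewrite ballEmdist => qp qmj; apply: pmj; exact: h qp qmj.
Qed.

Lemma borel_entry m j : borel [set p : tpart R K A | cls p m j].
Proof. apply: sub_sigma_algebra; exact: open_entry. Qed.

Lemma borel_array E : measurable (E : set arrayType) ->
  borel [set p : tpart R K A | E (cls p)].
Proof.
pose T := g_sigma_algebraType (@open (tpart R K A)).
apply: (@array_preimage _ T (fun p => cls p)).
exact: borel_entry.
Qed.

End borel_entries.

(** * Exchangeability at a fixed time *)

Lemma ae_le_measure d (T : measurableType d) (R : realType)
    (mu : {measure set T -> \bar R}) (A B : set T) :
  measurable A -> measurable B -> {ae mu, forall x, A x -> B x} ->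
  (mu A <= mu B)%E.
Proof.
move=> mA mB [N [mN N0 sub]].
have AB : A `<=` B `|` N.
  move=> x Ax; have [Bx|Bx] := pselect (B x); first by left.
  by right; apply: sub => /= h; exact/Bx/h.
apply: (@le_trans _ _ (mu (B `|` N))).
  by apply: le_measure; rewrite ?inE//; exact: measurableU.
have h : (mu (B `|` N) <= mu B + mu N)%E by exact: measureU2.
by rewrite (le_trans h)// N0 adde0.
Qed.

(** The mean density of a null set is 0, so the events of belonging to it
   cannot all be equally likely and of positive probability. *)
Lemma null_mean d (T : measurableType d) (R : realType) (mu : probability T R)
    (D : T -> set nat) (a : R) (m : nat) :
  (forall j, measurable [set w | D w j]) ->
  (forall j, j != m -> (a%:E <= mu [set w | D w j /\ null R (D w)])%E) ->
  a <= 0.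
Proof.
move=> mD ha; rewrite leNgt; apply/negP => a0.
pose F := [set w | null R (D w)].
have mF : measurable F by exact: measurable_null.
pose DF k := [set w | D w k /\ F w].
have mDF k : measurable (DF k) by apply: (measurableI _ _ (mD k) mF).
pose f n w : \bar R := (\sum_(k < n) n%:R^-1%:E * (\1_(DF k) w)%:E)%E.
have fE n w : f n w = (\1_F w * density R (D w) n)%:E.
  rewrite /f -ge0_sume_distrr; last by move=> k _; rewrite lee_fin.
  rewrite sumEFin -EFinM densityE; congr (_%:E).
  rewrite mulrA [RHS]mulrC; congr (_ * _).
  rewrite /cnt natr_sum mulr_sumr; apply: eq_bigr => k _.
  rewrite !indicE -natrM; congr (_%:R); rewrite mulnC mulnb; congr nat_of_bool.
  apply/idP/idP; first by rewrite inE => -[h1 h2]; apply/andP; split; [exact: asboolT|rewrite inE].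
  by move=> /andP[/asboolP h1]; rewrite !inE.
have mf n : measurable_fun setT (f n).
  apply: emeasurable_sum => k; apply: emeasurable_funM => //.
  by apply/measurable_EFinP; exact: measurable_indic.
have int n : (\int[mu]_w f n w = \sum_(k < n) n%:R^-1%:E * mu (DF k))%E.
  rewrite ge0_integral_sum//; last first.
    move=> k; apply: emeasurable_funM => //.
    by apply/measurable_EFinP; exact: measurable_indic.
  apply: eq_bigr => k _; rewrite ge0_integralZl//; last 1 first.
    by apply/measurable_EFinP; exact: measurable_indic.
  by rewrite integral_indic// setIT.
have : (\int[mu]_w f n w)%E @[n --> \oo] --> (\int[mu]_w 0)%E.
  apply: (@dominated_cvg _ _ _ mu _ measurableT f (cst 0%E) (cst 1%E)) => //.
  - move=> w _.
    have -> : f ^~ w = EFin \o (fun n => \1_F w * density R (D w) n).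
      by apply/funext => n; rewrite fE.
    apply: cvg_EFin; first by near=> n.
    rewrite indicE; case: (boolP (w \in F)) => [|_].
      by rewrite inE => /nullP Fw; under eq_fun do rewrite mul1r.
    by under eq_fun do rewrite mul0r; exact: cvg_cst.
  - exact: finite_measure_integrable_cst.
  - move=> n w _; rewrite fE gee0_abs ?lee_fin ?mulr_ge0 ?density_ge0//.
    by rewrite indicE mulr_ile1 ?density_ge0 ?density_le1//; case: (_ \in _).
rewrite integral0 => cv.
have : ((a / 2)%:E <= 0)%E.
  apply: (cvge_to_ge cv); exists 2%N => // n /= n2; rewrite int.
  apply: (@le_trans _ _ (\sum_(k < n | (k : nat) != m) n%:R^-1%:E * a%:E)%E).
    under eq_bigr do rewrite -EFinM; rewrite sumEFin lee_fin.
    set c := n%:R^-1 * a; have nc : n%:R * c = a.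
      by rewrite mulrA divff ?mul1r// pnatr_eq0 -lt0n (leq_trans _ n2).
    have ca : c <= a / 2.
      by rewrite /c mulrC ler_pM2l// lef_pV2 ?posrE ?ltr0n ?ler_nat ?(leq_trans _ n2).
    have : \sum_(k < n) c <= \sum_(k < n | (k : nat) != m) c + c.
      have [mn|nm] := ltnP m n.
        by rewrite (bigD1 (Ordinal mn))//= addrC.
      rewrite [X in _ <= X + _](eq_bigl xpredT).
        by rewrite lerDl mulr_ge0 ?invr_ge0// ltW.
      by move=> k /=; rewrite (ltn_eqF (leq_trans (ltn_ord k) nm)).
    have -> : \sum_(k < n) c = a by rewrite sumr_const card_ord -nc mulr_natl.
    lra.
  rewrite big_mkcond/=; apply: lee_sum => k _.
  case: ifP => [km|_]; last by rewrite mule_ge0// lee_fin invr_ge0.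
  by rewrite lee_wpmul2l ?lee_fin ?invr_ge0// ha.
by rewrite lee_fin; lra.
Unshelve. all: by end_near. Qed.

(** A block or its complement: one argument deals with blocks of frequency 0 and
   with blocks of frequency 1. *)
Definition side (b : bool) (B : set nat) : set nat := if b then B else ~` B.

Lemma side_preimage b (f : nat -> nat) B :
  side b (f @^-1` B) = f @^-1` side b B.
Proof. by case: b. Qed.

Section fixed_time.
Variables (R : realType) (K : nat) (alpha : R).
Variables (d : measure_display) (Omega : measurableType d).
Variables (P : tpart R K setT -> probability Omega R).
Variables (X : R -> Omega -> tpart R K setT).
Hypothesis frag : self_similar_fragmentation alpha P X.
Implicit Types (E : set array) (t z : R) (i : 'I_K).

Definition at_time t E : set Omega := [set w | E (cls (X t w))].

Lemma measurable_at_time t E : 0 <= t -> measurable (E : set arrayType) ->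
  measurable (at_time t E).
Proof.
move=> t0 mE.
exact: (markov_measurable (fragmentation_markov frag) t0 (borel_array mE)).
Qed.

Lemma measurable_at_entry t m j : 0 <= t -> measurable [set w | cls (X t w) m j].
Proof. by move=> t0; exact: measurable_at_time t0 (array_entry m j). Qed.

Lemma same_law_at (A : set nat) (Q Q' : probability Omega R)
    (Y Z : R -> Omega -> tpart R K A) t E :
  same_law Q Y Q' Z -> 0 <= t -> measurable (E : set arrayType) ->
  Q [set w | E (cls (Y t w))] = Q' [set w | E (cls (Z t w))].
Proof.
move=> YZ t0 mE; have := YZ [set f : R -> tpart R K A | E (cls (f t))].
apply.
apply: sub_sigma_algebra; exists t, [set p : tpart R K A | E (cls p)].
split=> //.
exact: borel_array.
Qed.

Lemma exchange_bij i s (sB : bijective s) t E : 0 <= t ->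
  measurable (E : set arrayType) ->
  P (one_block i) [set w | E (fun m => s @^-1` cls (X t w) (s m))] =
  P (one_block i) (at_time t E).
Proof.
move=> t0 mE.
by rewrite -(same_law_at (fragmentation_exchangeable frag i sB) t0 mE).
Qed.

(** An injection agrees on any finite set of integers with a bijection, so
   finite-dimensional laws, hence laws, are invariant under injections. *)
Lemma exchange_inj i (phi : nat -> nat) t E : injective phi -> 0 <= t ->
  measurable (E : set arrayType) ->
  P (one_block i) [set w | E (fun m => phi @^-1` cls (X t w) (phi m))] =
  P (one_block i) (at_time t E).
Proof.
move=> phiI t0; set mu := P (one_block i).
pose c (w : Omega) : array := cls (X t w).
pose c' (w : Omega) : array := fun m => phi @^-1` c w (phi m).
have mc m j : measurable [set w | c w m j] by exact: measurable_at_entry.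
have mc' m j : measurable [set w | c' w m j] by exact: measurable_at_entry.
pose H : set (set array) := [set F | measurable (F : set arrayType) /\
  mu (c' @^-1` F) = mu (c @^-1` F)].
suff sub : <<s cylinder >> `<=` H by move=> /sub[].
apply: lambda_system_subset => //; first exact: cylinderI.
- split=> //.
  + move=> A B BA [mA eA] [mB eB]; split; first exact: measurableD.
    have D (a : Omega -> array) : (forall m j, measurable [set w | a w m j]) ->
        mu (a @^-1` (A `\` B)) = (mu (a @^-1` A) - mu (a @^-1` B))%E.
      move=> ma; have [mA' mB'] := (array_preimage ma mA, array_preimage ma mB).
      rewrite [LHS](measureD (mu := mu) mA' mB')//.
        by rewrite -preimage_setI (setIidr BA).
      by rewrite (le_lt_trans (probability_le1 mu mA'))// ltry.
    by rewrite (D _ mc) (D _ mc') eA eB.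
  + move=> F ndF HF; have mF n := (HF n).1.
    split; first exact: bigcupT_measurable.
    rewrite !preimage_bigcup.
    have lim (a : Omega -> array) : (forall m j, measurable [set w | a w m j]) ->
        mu (a @^-1` F n) @[n --> \oo] --> mu (\bigcup_n a @^-1` F n).
      move=> ma; apply: nondecreasing_cvg_mu.
      * by move=> n; exact: array_preimage.
      * by apply: bigcupT_measurable => n; exact: array_preimage.
      * move=> n k nk; apply/subsetPset => w /=.
        by move/subsetPset: (ndF _ _ nk); apply.
    have := lim _ mc'; under eq_fun do rewrite (HF _).2.
    by move=> /cvg_unique; apply => //; exact: lim mc.
- move=> _ [s ->]; split; first by apply: sub_sigma_algebra; exists s.
  have [n sn] : exists n, forall x, x \in s -> (x.1 < n)%N /\ (x.2 < n)%N.
    elim: s => [|x s [n h]]; first by exists 0%N.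
    exists (maxn n (maxn x.1 x.2).+1) => y; rewrite inE => /predU1P[->|/h[a b]].
      by rewrite !leq_max !ltnS !leq_max !leqnn !orbT.
    by rewrite !leq_max a b.
  have [u uB uE] := inj_extend n phiI.
  rewrite -[RHS](exchange_bij i uB t0); last by apply: sub_sigma_algebra; exists s.
  congr (mu _); apply/seteqP; split=> w h x xs; have [x1 x2] := sn x xs;
    by move: (h x xs); rewrite /c' /preimage/= !uE.
Qed.

(** Exchanging j and k leaves m fixed, so the probability is the same for all j
   other than m, and null_mean applies. *)
Lemma null_side i t b m j : 0 <= t -> m != j ->
  P (one_block i) [set w | side b (cls (X t w) m) j /\
                           null R (side b (cls (X t w) m))] = 0%E.
Proof.
move=> t0 mj; set mu := P (one_block i).
have mS k : measurable ([set c | side b (c m) k] : set arrayType).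
  rewrite /side; case: b; first exact: array_entry.
  by apply: measurableC; exact: array_entry.
have mE k : measurable ([set c | side b (c m) k /\ null R (side b (c m))] :
    set arrayType).
  apply: measurableI; first exact: mS.
  exact: (measurable_null (T := arrayType)) mS.
pose D w := side b (cls (X t w) m).
have mD k : measurable [set w | D w k] by exact: measurable_at_time t0 (mS k).
pose E0 := at_time t [set c | side b (c m) j /\ null R (side b (c m))].
rewrite -/mu -[[set w | _]]/E0.
have le1 : (mu E0 <= 1)%E by exact: probability_le1 (measurable_at_time t0 (mE j)).
have ge0 : (0 <= mu E0)%E by exact: measure_ge0.
move: le1 ge0; case Ea : (mu E0) => [a| |]; rewrite ?lee_fin// => _ a0.
suff : a <= 0 by move=> a0'; congr (_%:E); apply/eqP; rewrite eq_le a0' a0.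
apply: (@null_mean _ _ _ mu D a m mD) => k km.
have ks : swap j k m = m by rewrite swapD// eq_sym.
rewrite -Ea /E0 -(exchange_bij i (swap_bij j k) t0 (mE j)).
apply: le_measure; rewrite ?inE.
- have -> : [set w | [set c | side b (c m) j /\ null R (side b (c m))]
      (fun m' => swap j k @^-1` cls (X t w) (swap j k m'))] =
    [set w | (swap j k @^-1` D w) j /\ null R (swap j k @^-1` D w)].
    by apply/seteqP; split=> w /=; rewrite ks side_preimage.
  apply: measurableI; first exact: mD.
  by apply: measurable_null => l; exact: mD.
- by apply: measurableI; [exact: mD|exact: measurable_null].
- move=> w /=; rewrite ks side_preimage /preimage/= swapL => -[Dk nD]; split=> //.
  have := null_swap j k nD; congr (null R _).
  by apply/seteqP; split=> l; rewrite /preimage/= swapK.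
Qed.


Lemma all_freq_one_block i : all_freq (one_block i : tpart R K setT).
Proof.
move=> m; apply: cvgP (_ : _ --> (1 : R)); apply: cvg_near_cst; exists 1%N => // n /= n0.
have -> : [set: nat] = ~` set0 by rewrite setC0.
rewrite density_setC// densityE /cnt big1 ?mul0r ?subr0// => k _.
by case: asboolP.
Qed.

Lemma ae_has_freq i t : 0 <= t ->
  {ae P (one_block i), forall w, all_freq (X t w)}.
Proof.
move=> t0; have := fragmentation_freq frag (@all_freq_one_block i).
apply: filterS.
by move=> w h m; exact: (h m).1.
Qed.

Lemma ae_not_null_side i t : 0 <= t -> {ae P (one_block i), forall w,
  forall b m j, m != j -> side b (cls (X t w) m) j ->
    ~ null R (side b (cls (X t w) m))}.
Proof.
move=> t0.
suff h b : {ae P (one_block i), forall w, forall m j, m != j ->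
    side b (cls (X t w) m) j -> ~ null R (side b (cls (X t w) m))}.
  by apply: filterS2 (h true) (h false) => w h1 h2 [].
apply: ae_foralln => m; apply: ae_foralln => j.
have [->|mj] := eqVneq m j; first exact: aeW.
exists [set w | side b (cls (X t w) m) j /\ null R (side b (cls (X t w) m))].
split.
- have mS k : measurable [set w | side b (cls (X t w) m) k].
    rewrite /side; case: b; first exact: measurable_at_entry.
    by apply: measurableC; exact: measurable_at_entry.
  by apply: measurableI; [exact: mS|exact: measurable_null].
- exact: null_side.
- by move=> w /= /not_implyP[_ /not_implyP[wj /contrapT nw]].
Qed.

Definition nondust : set array := [set c | exists m j, m != j /\ c m j].

Definition cut : set array := [set c | exists m j, ~ c m j].

Lemma array_nondust : measurable (nondust : set arrayType).
Proof.
have -> : nondust = \bigcup_m \bigcup_(j in [set j | m != j]) [set c | c m j].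
  apply/seteqP; split=> c; first by move=> [m [j [mj cmj]]]; exists m => //; exists j.
  by move=> [m _ [j mj cmj]]; exists m, j.
apply: bigcupT_measurable => m; apply: bigcup_measurable => j _.
exact: array_entry.
Qed.

Lemma array_cut : measurable (cut : set arrayType).
Proof.
have -> : cut = \bigcup_m \bigcup_j ~` [set c | c m j].
  apply/seteqP; split=> c; first by move=> [m [j cmj]]; exists m => //; exists j.
  by move=> [m _ [j _ cmj]]; exists m, j.
apply: bigcupT_measurable => m; apply: bigcupT_measurable => j.
by apply: measurableC; exact: array_entry.
Qed.

(** A null block with a second element is excluded by null_side. *)
Lemma dust_big i t : 0 <= t ->
  (P (one_block i) (at_time t nondust) <=
   P (one_block i) (at_time t (big (0 : R))))%E.
Proof.
move=> t0; apply: ae_le_measure.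
- exact: measurable_at_time array_nondust.
- exact: measurable_at_time (array_big _).
- apply: filterS2 (ae_has_freq i t0) (ae_not_null_side i t0) => w fw nw.
  move=> [m [j [mj cmj]]]; exists m; apply: contrapT => e.
  exact: nw true m j mj cmj (not_exceeds_null (fw m) e).
Qed.

(** A block whose complement is null and nonempty is excluded by null_side. *)
Lemma cut_small i t : 0 <= t ->
  (P (one_block i) (at_time t cut) <=
   P (one_block i) (\bigcup_k at_time t (~` big (1 - k.+2%:R^-1 : R))))%E.
Proof.
move=> t0; apply: ae_le_measure.
- exact: measurable_at_time array_cut.
- apply: bigcupT_measurable => k; apply: measurable_at_time => //.
  by apply: measurableC; exact: array_big.
- apply: filterS (ae_not_null_side i t0) => w nw [m [j mj]].
  apply: contrapT => allbig.
  have {}allbig k : big (1 - k.+2%:R^-1 : R) (cls (X t w)).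
    by apply: contrapT => nk; apply: allbig; exists k.
  (* A block above 1/2 is unique, so that of m0 is above 1 - 1 / (k + 2) for
     all k. *)
  have [m0 e0] := allbig 0%N.
  have [j0 j0m] : exists j0, ~ cls (X t w) m0 j0.
    apply: contrapT => /forallNP h; apply: mj.
    by rewrite (cls_eq (contrapT (h m))); exact: contrapT (h j).
  have m0j0 : m0 != j0.
    by apply/eqP => e; apply: j0m; rewrite -e; exact: cls_refl.
  apply: (nw false m0 j0 m0j0 j0m); apply: exceeds_null_setC => k.
  have [m1 e1] := allbig k.
  suff -> : cls (X t w) m0 = cls (X t w) m1.
    apply: exceeds_le e1 => //; rewrite lerD2l lerN2 lef_pV2 ?posrE ?ltr0n//.
    by rewrite ler_nat.
  apply: contrapT => m01.
  apply: (@exceeds_disjoint R [:: m0; m1] (cls (X t w)) 2^-1).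
  + move=> l a b; rewrite !inE => /orP[]/eqP-> /orP[]/eqP->// la lb.
      by case: m01; rewrite -(cls_eq la) (cls_eq lb).
    by case: m01; rewrite -(cls_eq la) (cls_eq lb).
  + by rewrite /= inE andbT; apply/eqP => e; apply: m01; rewrite e.
  + move=> a; rewrite !inE => /orP[]/eqP->.
      by apply: exceeds_le e0 => //; lra.
    apply: exceeds_le e1 => //.
    have : k.+2%:R^-1 <= 2^-1 :> R by rewrite lef_pV2 ?posrE ?ltr0n// ler_nat.
    by move: k.+2%:R^-1 => x; lra.
  + by rewrite /= divff.
Qed.

(** By right-continuity, a path that is in one block at all rational times is in
   one block at all times. *)
Lemma nonconstant_cut i : nonconstant_partition P X ->
  exists2 t, 0 <= t & (0 < P (one_block i) (at_time t cut))%E.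
Proof.
move=> /(_ i) ncst; apply: contrapT => never; apply: ncst.
have ae0 k l : {ae P (one_block i), forall w,
    forall m j, cls (X (k%:R / l.+1%:R) w) m j}.
  have t0 : 0 <= k%:R / l.+1%:R :> R by rewrite divr_ge0.
  exists (at_time (k%:R / l.+1%:R) cut); split.
  - exact: measurable_at_time array_cut.
  - apply/eqP; rewrite eq_le measure_ge0 andbT leNgt; apply/negP => h.
    by apply: never; exists (k%:R / l.+1%:R).
  - move=> w /= /existsNP[m /existsNP[j mj]]; by exists m, j.
have := ae_foralln (fun k => ae_foralln (fun l => ae0 k l)).
apply: filterS => w allq.
have full t : 0 <= t -> cls (X t w) = fun=> setT.
  move=> t0; apply/funext => m; apply/seteqP; split=> // j _.
  apply: contrapT => mj.
  have rc := (fragmentation_cadlag frag w).1 t t0.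
  have : \forall u \near t^'+, ~ cls (X u w) m j.
    apply: (rc [set p : tpart R K setT | ~ cls p m j]).
    by apply: open_nbhs_nbhs; split=> //; exact: open_entryC.
  rewrite near_withinE => /nbhs_ballP[e /= e0 he].
  have [l le] := inv_ltP e0.
  pose k := (Num.truncn (t * l.+1%:R)).+1.
  have l0 : 0 < l.+1%:R :> R by rewrite ltr0n.
  have tk : t < k%:R / l.+1%:R by rewrite ltr_pdivlMr// truncnS_gt.
  have kt : k%:R / l.+1%:R <= t + l.+1%:R^-1.
    rewrite ler_pdivrMr// mulrDl mulVf ?gt_eqF// /k -natr1 lerD2r.
    by rewrite truncn_le// mulr_ge0.
  apply: (he (k%:R / l.+1%:R)) => //=.
    by rewrite /ball/= ltr0_norm ?subr_lt0// opprB ltrBlDl (le_lt_trans kt)// ltrD2l.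
by move=> t t0; rewrite (full t t0) (full 0 (lexx _)).
Qed.

End fixed_time.

(** * The Markov and branching properties at fixed times *)

Section blocks.
Variables (R : realType) (K : nat).
Implicit Types p : typed_partition K setT.

Lemma block_cls p m : exists n, block p n = cls p m.
Proof.
have ex : exists k, `[< cls p m k >] by exists m; apply/asboolP; exact: cls_refl.
pose l := ex_minn ex.
have [lm lmin] : cls p m l /\ forall j, cls p m j -> (l <= j)%N.
  rewrite /l; case: ex_minnP => k /asboolP mk kmin; split=> // j mj.
  by apply: kmin; exact/asboolP.
have ml : cls p l = cls p m by exact: cls_eq lm.
have ll : leader p l by split; [exact: cls_refl|rewrite ml].
exists #|[pred j : 'I_l | `[< leader p j >]]|.
have cardE a : #|[pred j : 'I_a | `[< leader p j >]]| = cnt (leader p) a.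
  by rewrite /cnt -sum1_card big_mkcond.
have leader_inj a b : leader p a -> leader p b ->
    cnt (leader p) a = cnt (leader p) b -> (b <= a)%N.
  move=> la lb e; rewrite leqNgt; apply/negP => ab.
  have := cnt_mono (leader p) ab.
  by rewrite cntS asboolT// addn1 e ltnn.
apply/seteqP; split=> x; last by move=> mx; exists l; split=> //; rewrite ml.
move=> [l' [ll' e l'x]]; rewrite !cardE in e.
suff ll'E : l' = l by rewrite -ml -ll'E.
by apply/eqP; rewrite eqn_leq; apply/andP; split; exact: leader_inj.
Qed.

Lemma exceeds_btype p m n (z : R) : 0 <= z -> exceeds z (cls p m) ->
  block p n = cls p m -> exists i : 'I_K, btype p n = lift ord0 i.
Proof.
move=> z0 em nm.
have tm : typ p m <> ord0.
  move=> /typ0P sub; have [k] := exceeds_infinite z0 em 1.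
  rewrite ltnNge => /negP; apply; apply: (leq_trans (subset_cnt k sub)).
  elim: k => [|k IH]; first by rewrite cnt0.
  rewrite cntS; case: asboolP => [/= ->|]; last by rewrite addn0.
  suff -> : cnt [set m] m = 0%N by [].
  rewrite /cnt big1// => j _; case: asboolP => //= jm.
  by have := ltn_ord j; rewrite jm ltnn.
have [x mx ex] : (typ p @` block p n) (btype p n).
  rewrite /btype; apply: xgetPex; exists (typ p m); exists m => //.
  by rewrite nm; exact: cls_refl.
have : btype p n != ord0 by rewrite -ex; apply/eqP; rewrite nm in mx; rewrite (typ_eq mx).
by rewrite eq_sym => /unlift_some[i e _]; exists i.
Qed.

(** Blocks above z, taken one at a time, run out before there are N + 1 of them
   by exceeds_disjoint. *)
Lemma exceeds_cover p (z : R) N : 1 <= N.+1%:R * z -> exists L : seq nat,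
  [/\ (size L <= N)%N, forall i, i \in L -> exceeds z (cls p i) &
      forall m, exceeds z (cls p m) -> exists2 i, i \in L & cls p m = cls p i].
Proof.
move=> Nz.
suff [k] : exists k : nat, (k <= N)%N /\ exists L : seq nat,
  [/\ size L = k, forall i, i \in L -> exceeds z (cls p i) &
      forall m, exceeds z (cls p m) -> exists2 i, i \in L & cls p m = cls p i].
  by move=> [kN [L [Lk h1 h2]]]; exists L; rewrite Lk.
apply: contrapT => nocover.
suff : exists L : seq nat, [/\ size L = N.+1, uniq L,
    forall i, i \in L -> exceeds z (cls p i) &
    forall i j, i \in L -> j \in L -> cls p i = cls p j -> i = j].
  move=> [L [sL uL eL iL]]; apply: (@exceeds_disjoint R L (cls p) z) => //.
    by move=> k i j iL' jL' ik jk; apply: iL => //; rewrite -(cls_eq ik) (cls_eq jk).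
  by rewrite sL.
have : (N.+1 <= N.+1)%N by [].
move: {1 3}N.+1 => k; elim: k => [|k IH] kN; first by exists [::].
have [L [sL uL eL iL]] := IH (ltnW kN).
have [m em mL] : exists2 m, exceeds z (cls p m) &
    forall i, i \in L -> cls p m <> cls p i.
  apply: contrapT => h; apply: nocover; exists k; split=> //; exists L; split=> // m em.
  apply: contrapT => h'; apply: h; exists m => // i iL' e; apply: h'; by exists i.
exists (m :: L); split=> //=.
- by rewrite sL.
- by rewrite uL andbT; apply/negP => /mL.
- by move=> i; rewrite inE => /predU1P[->|/eL].
- move=> i j; rewrite !inE => /predU1P[->|iL'] /predU1P[->|jL']//.
  + by move=> /(mL _ jL').
  + by move=> /esym/(mL _ iL').
  + exact: iL.
Qed.

End blocks.

Lemma measure_seq_le d (T : measurableType d) (R : realType)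
    (mu : {measure set T -> \bar R}) (L : seq nat) (F : nat -> set T) (q : R) :
  (forall i, measurable (F i)) -> (forall i, i \in L -> (mu (F i) <= q%:E)%E) ->
  measurable [set w | exists2 i, i \in L & F i w] /\
  (mu [set w | exists2 i, i \in L & F i w] <= ((size L)%:R * q)%:E)%E.
Proof.
move=> mF; elim: L => [|a L IH] Fq.
  rewrite (_ : [set w | _] = set0); last by apply/seteqP; split=> w // [].
  by rewrite measure0 mul0r.
have [|mL qL] := IH; first by move=> i iL; apply: Fq; rewrite inE iL orbT.
rewrite (_ : [set w | _] = F a `|` [set w | exists2 i, i \in L & F i w]).
  split; first exact: measurableU.
  have h := measureU2 mu (mF a) mL.
  rewrite (le_trans h)// -natr1 mulrDl mul1r addrC EFinD leeD// Fq//.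
  exact: mem_head.
apply/seteqP; split=> w.
  by move=> [i]; rewrite inE => /predU1P[->|iL Fi]; [left|right; exists i].
by move=> [Fa|[i iL Fi]]; [exists a; rewrite ?mem_head|exists i; rewrite ?inE ?iL ?orbT].
Qed.

Section branching.
Variables (R : realType) (K : nat) (alpha : R).
Variables (d : measure_display) (Omega : measurableType d).
Variables (P : tpart R K setT -> probability Omega R).
Variables (X : R -> Omega -> tpart R K setT).
Hypothesis alpha0 : alpha < 0.
Hypothesis frag : self_similar_fragmentation alpha P X.
Implicit Types (A B : set array) (s t y z th q : R) (i : 'I_K) (p : tpart R K setT).

Let mat t B : 0 <= t -> measurable (B : set arrayType) ->
  measurable (at_time X t B).
Proof. exact: measurable_at_time frag _ _. Qed.

Lemma markov_le i s t A B q : 0 <= s -> 0 <= t -> 0 <= q ->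
  measurable (A : set arrayType) -> measurable (B : set arrayType) ->
  (forall p, all_freq p -> A (cls p) -> (P p (at_time X t B) <= q%:E)%E) ->
  (P (one_block i) (at_time X s A `&` at_time X (s + t) B) <=
   q%:E * P (one_block i) (at_time X s A))%E.
Proof.
move=> s0 t0 q0 mA mB h; have mk := fragmentation_markov frag.
pose B' := [set p : tpart R K setT | B (cls p)].
have bB : borel B' by exact: borel_array.
have hA : history X s (at_time X s A).
  apply: sub_sigma_algebra; exists s, [set p : tpart R K setT | A (cls p)].
  by split; [rewrite s0 lexx|exact: borel_array|].
have mAs : measurable (at_time X s A) by exact: mat.
rewrite [leLHS](markov_property mk (one_block i) s0 t0 hA bB).
rewrite -integral_cst//; apply: ae_ge0_le_integral => //.
- apply: measurable_funTS.
  pose T := g_sigma_algebraType (@open (tpart R K setT)).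
  apply: (@measurableT_comp _ _ _ _ T _ (fun p => P p (X t @^-1` B'))).
    exact: (markov_kernel mk t0 bB).
  move=> _ C mC; rewrite setTI; exact: (markov_measurable mk s0 mC).
- have := ae_has_freq frag i s0; apply: filterS => w fw Aw.
  exact: h.
Qed.

Lemma fragment_small p t z : all_freq p -> 0 <= t -> ~ big z (cls p) ->
  P p (at_time X t (big z)) = 0%E.
Proof.
move=> fp t0 zp; apply/eqP; rewrite eq_le measure_ge0 andbT.
rewrite -(measure0 (P p)); apply: ae_le_measure => //.
  by apply: mat => //; exact: array_big.
have := fragmentation_fragments frag fp; apply: filterS => w sub bw.
by apply: zp; apply: big_sub bw => m; exact: sub.
Qed.

Lemma at_time_split i s t A B : 0 <= s -> 0 <= t ->
  measurable (A : set arrayType) -> measurable (B : set arrayType) ->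
  (P (one_block i) (at_time X t B) <=
   P (one_block i) (at_time X s A `&` at_time X t B) +
   P (one_block i) (at_time X s (~` A) `&` at_time X t B))%E.
Proof.
move=> s0 t0 mA mB; set mu := P (one_block i).
have mAC : measurable (~` A : set arrayType) by exact: measurableC.
have m1 : measurable (at_time X s A `&` at_time X t B).
  by apply: measurableI; exact: mat.
have m2 : measurable (at_time X s (~` A) `&` at_time X t B).
  by apply: measurableI; exact: mat.
have h := measureU2 mu m1 m2; apply: le_trans h.
apply: le_measure; rewrite ?inE; [exact: mat|exact: measurableU|].
move=> w tw; have [sw|sw] := pselect (A (cls (X s w))); first by left.
by right.
Qed.

(** Blocks only shrink, so no block above z appears after time s. *)
Lemma big_time_new i s t z : 0 <= s -> s <= t ->
  P (one_block i) (at_time X s (~` big z) `&` at_time X t (big z)) = 0%E.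
Proof.
move=> s0 st; have ts0 : 0 <= t - s by rewrite subr_ge0.
have mz : measurable (big z : set arrayType) by exact: array_big.
have mzC : measurable (~` big z : set arrayType) by exact: measurableC.
have := @markov_le i s (t - s) (~` big z) (big z) 0 s0 ts0 (lexx _) mzC mz.
have -> : s + (t - s) = t by rewrite addrC subrK.
rewrite mul0e => h; apply/eqP; rewrite eq_le measure_ge0 andbT.
by apply: h => p fp zp; rewrite (fragment_small fp ts0 zp).
Qed.

Lemma big_time_mono i s t z : 0 <= s -> s <= t ->
  (P (one_block i) (at_time X t (big z)) <= P (one_block i) (at_time X s (big z)))%E.
Proof.
move=> s0 st; have t0 : 0 <= t by exact: le_trans st.
have mz : measurable (big z : set arrayType) by exact: array_big.
apply: (le_trans (at_time_split i s0 t0 mz mz)).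
rewrite [X in (_ + X)%E](big_time_new i z s0 st) adde0.
apply: le_measure; rewrite ?inE; last by move=> w [].
  by apply: measurableI; exact: mat.
exact: mat.
Qed.

(** Uniformity over the initial type is what makes the estimate applicable to
   blocks whose type is not controlled. *)
Definition big_le_prob t z q : Prop :=
  forall i, (P (one_block i) (at_time X t (big z)) <= q%:E)%E.

Lemma powR_neg_ge1 x y : 0 < x -> x <= y -> 1 <= x `^ alpha * y `^ (- alpha).
Proof.
move=> x0 xy; have y0 : 0 < y by exact: lt_le_trans xy.
rewrite -[X in x `^ X]opprK [x `^ _]powRN mulrC ler_pdivlMr ?powR_gt0// mul1r.
by apply: ge0_ler_powR => //; rewrite ?nnegrE ?oppr_ge0; exact: ltW.
Qed.

Lemma measurable_restr_big (C : set nat) t z : 0 <= t ->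
  measurable [set w | big z (cls (restr C (X t w)))].
Proof.
move=> t0; apply: array_preimage (array_big z) => a b.
have [[Ca Cb]|nC] := pselect (C a /\ C b).
  rewrite (_ : [set _ | _] = [set w | cls (X t w) a b]).
    exact: (measurable_at_entry frag).
  by apply/seteqP; split=> w; [case|].
rewrite (_ : [set _ | _] = set0)//.
by apply/seteqP; split=> w // [Ca Cb _]; apply: nC.
Qed.

(** Self-similarity: inside a block of frequency x, a fragment of frequency
   above z >= th x corresponds, through the enumeration of the block, to one of
   frequency above th for the process started from all integers and observed
   at time x^alpha u >= t. *)
Lemma restr_big p m z th u t q : all_freq p -> exceeds z (cls p m) ->
  0 <= z -> 0 <= th -> th * freq R (cls p m) <= z -> 0 <= u -> 0 <= t ->
  t <= freq R (cls p m) `^ alpha * u -> big_le_prob t th q ->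
  (P p [set w | big z (cls (restr (cls p m) (X u w)))] <= q%:E)%E.
Proof.
move=> fp em z0 th0 thz u0 t0 tu Gq; have [n nm] := block_cls p m.
have [i ti] := exceeds_btype z0 em nm.
set x := freq R (cls p m) in thz tu *.
have x0 : 0 < x by rewrite (le_lt_trans z0)//; apply/exceeds_freq.
have := same_law_at (fragmentation_law frag fp ti _) u0 (array_big z).
rewrite /restr_process nm => -> //; rewrite -/x.
set v := x `^ alpha * u in tu *.
have v0 : 0 <= v by exact: le_trans tu.
apply: le_trans (Gq i); apply: (@le_trans _ _ _ _ _ _ (big_time_mono i th t0 tu)).
have [phi [phiI Bphi phiB cphi]] := enumerate (exceeds_infinite z0 em).
rewrite -(exchange_inj frag i phiI v0 (array_big th)).
apply: le_measure; rewrite ?inE.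
- exact: measurable_restr_big.
- apply: (array_preimage (c := fun w k => phi @^-1` cls (X v w) (phi k))) (array_big th).
  by move=> a b; exact: (measurable_at_entry frag).
- move=> w [a ea]; have Ba : cls p m a.
    apply: contrapT => Ba; have [k] := exceeds_infinite z0 ea 0.
    by rewrite /cnt big1// => j _; case: asboolP => // -[].
  exists (cnt (cls p m) a).
  have := @exceeds_enumerate R (cls p m) _ phi th z x th0 _ (fp m) erefl
    (exceeds_infinite z0 em) phiB cphi Bphi thz ea.
  have -> : phi @^-1` cls (restr (cls p m) (X v w)) a =
      phi @^-1` cls (X v w) (phi (cnt (cls p m) a)).
    rewrite phiB//; apply/seteqP; split=> k; first by case.
    by split.
  by apply=> k [].
Qed.

(** A fragment of frequency above th y comes from one of the at most N blocks that
   are above th y. Such a block has frequency x <= y, so time y^-alpha t is for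
   it time x^alpha y^-alpha t >= t on the scale of the initial block. *)
Lemma branch p y th t q N : all_freq p -> ~ big y (cls p) -> 0 < y -> 0 < th ->
  0 <= t -> 0 <= q -> 1 <= N.+1%:R * (th * y) -> big_le_prob t th q ->
  (P p (at_time X (y `^ (- alpha) * t) (big (th * y))) <= (N%:R * q)%:E)%E.
Proof.
move=> fp yp y0 th0 t0 q0 Nz Gq; set u := y `^ _ * t; set z := th * y in Nz *.
have u0 : 0 <= u by rewrite mulr_ge0// powR_ge0.
have z0 : 0 < z by rewrite mulr_gt0.
have [L [LN eL covL]] := exceeds_cover p Nz.
pose F k := [set w | big z (cls (restr (cls p k) (X u w)))].
have [||mU qU] := @measure_seq_le _ _ _ (P p) L F q.
- by move=> k; exact: measurable_restr_big.
- move=> k kL; have ek := eL k kL.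
  have zx : z < freq R (cls p k) by apply/exceeds_freq.
  have xy : freq R (cls p k) <= y.
    rewrite leNgt; apply/negP => yx; apply: yp; exists k; exact/exceeds_freq.
  apply: (restr_big (t := t) (th := th)) => //; try exact: ltW.
    by rewrite ler_wpM2l// ltW.
  by rewrite mulrA ler_peMl// powR_neg_ge1// (lt_trans z0).
apply: le_trans (_ : _ <= ((size L)%:R * q)%:E)%E _; last first.
  by rewrite lee_fin ler_wpM2r// ler_nat.
apply: le_trans qU; apply: ae_le_measure => //.
  by apply: mat => //; exact: array_big.
have := fragmentation_fragments frag fp; apply: filterS => w sub [m em].
have sm := sub u u0 m.
have [k kL mk] := covL m (exceeds_le (lexx _) sm em).
exists k => //; exists m; apply: exceeds_le em => // j mj; split=> //.
  by rewrite -mk; exact: cls_refl.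
by rewrite -mk; exact: sm.
Qed.

(** A is free inside the complement of big y: the recursions on levels use the
   whole complement, the recursion at the fixed level 1/2 uses big 1/2, with
   y = 1. *)
Lemma branch_step i A s y th t q N : measurable (A : set arrayType) ->
  A `<=` ~` big y -> 0 <= s -> 0 < y -> 0 < th -> 0 <= t -> 0 <= q ->
  1 <= N.+1%:R * (th * y) -> big_le_prob t th q ->
  (P (one_block i) (at_time X s A `&`
     at_time X (s + y `^ (- alpha) * t) (big (th * y))) <=
   (N%:R * q)%:E * P (one_block i) (at_time X s A))%E.
Proof.
move=> mA Ay s0 y0 th0 t0 q0 Nz Gq; apply: markov_le => //.
- by rewrite mulr_ge0// powR_ge0.
- by rewrite mulr_ge0.
- exact: array_big.
- by move=> p fp Ap; apply: branch => //; exact: Ay.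
Qed.

Lemma big_le_prob_mono s t z z' q q' : 0 <= s -> s <= t -> z <= z' -> q <= q' ->
  big_le_prob s z q -> big_le_prob t z' q'.
Proof.
move=> s0 st zz qq h i; apply: (le_trans (big_time_mono i z' s0 st)).
apply: le_trans (_ : _ <= q%:E)%E _; last by rewrite lee_fin.
apply: le_trans (h i); apply: le_measure; rewrite ?inE.
- by apply: mat => //; exact: array_big.
- by apply: mat => //; exact: array_big.
- by move=> w; exact: big_le.
Qed.

End branching.

(** * Extinction has exponential tails *)

Section iteration.
Variables (R : realType) (K : nat) (alpha : R).
Variables (d : measure_display) (Omega : measurableType d).
Variables (P : tpart R K setT -> probability Omega R).
Variables (X : R -> Omega -> tpart R K setT).
Hypothesis alpha0 : alpha < 0.
Hypothesis frag : self_similar_fragmentation alpha P X.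
Implicit Types (A B : set array) (s t y z th q : R) (i : 'I_K) (p : tpart R K setT).

Let mat t B : 0 <= t -> measurable (B : set arrayType) ->
  measurable (at_time X t B).
Proof. exact: measurable_at_time frag _ _. Qed.

Let prE i t B : 0 <= t -> measurable (B : set arrayType) ->
  exists2 x : R, P (one_block i) (at_time X t B) = x%:E & 0 <= x <= 1.
Proof.
move=> t0 mB; have m := mat t0 mB.
have : (P (one_block i) (at_time X t B) <= 1)%E by exact: probability_le1.
have : (0 <= P (one_block i) (at_time X t B))%E by exact: measure_ge0.
case: (P (one_block i) (at_time X t B)) => [x| |]//.
by rewrite !lee_fin => x0 x1; exists x; rewrite ?x0.
Qed.

Let array_bigC z : measurable (~` big z : set arrayType).
Proof. by apply: measurableC; exact: array_big. Qed.

Let prC i t B : 0 <= t -> measurable (B : set arrayType) ->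
  (P (one_block i) (at_time X t (~` B)) =
   1 - P (one_block i) (at_time X t B))%E.
Proof. by move=> t0 mB; exact: (probability_setC _ (mat t0 mB)). Qed.

(** Blocks of frequency above z = th y at the later time come from a block above
   y at time s, or from one of the at most N blocks of frequency in (z, y]. *)
Lemma big_le_prob_step s y r t th q N : 0 <= s -> 0 < y -> 0 < th ->
  0 <= t -> 0 <= q -> N%:R * q <= 1 -> 1 <= N.+1%:R * (th * y) ->
  big_le_prob P X s y r -> big_le_prob P X t th q ->
  big_le_prob P X (s + y `^ (- alpha) * t) (th * y)
    (r + N%:R * q * (1 - r)).
Proof.
move=> s0 y0 th0 t0 q0 Nq1 Nz hr hq i.
have my : measurable (big y : set arrayType) by exact: array_big.
have mz : measurable (big (th * y) : set arrayType) by exact: array_big.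
have t0' : 0 <= s + y `^ (- alpha) * t by rewrite addr_ge0// mulr_ge0// powR_ge0.
apply: (le_trans (at_time_split frag i s0 t0' my mz)).
have [x xE /andP[x0 x1]] := prE i s0 my.
have xr : x <= r by have := hr i; rewrite xE lee_fin.
have e2 := branch_step alpha0 frag i (array_bigC y) (@subset_refl _ _) s0 y0 th0
  t0 q0 Nz hq.
have PC : P (one_block i) (at_time X s (~` big y)) = (1 - x)%:E.
  by rewrite prC// xE.
rewrite PC in e2.
have e1 : (P (one_block i) (at_time X s (big y) `&`
    at_time X (s + y `^ (- alpha) * t) (big (th * y))) <= x%:E)%E.
  rewrite -xE; apply: le_measure; rewrite ?inE; last by move=> w [].
    by apply: measurableI; exact: mat.
  exact: mat.
apply: (le_trans (leeD e1 e2)); rewrite -EFinM -EFinD lee_fin.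
have Nq0 : 0 <= N%:R * q by rewrite mulr_ge0.
rewrite -subr_ge0.
have -> : r + N%:R * q * (1 - r) - (x + N%:R * q * (1 - x)) =
  (r - x) * (1 - N%:R * q) by ring.
by rewrite mulr_ge0// subr_ge0.
Qed.

(** If N q > 1 the bound is trivial; otherwise the factor 1 - r is dropped. *)
Lemma big_le_prob_add s y r t th q N : 0 <= s -> 0 < y -> 0 < th ->
  0 <= t -> 0 <= q -> 0 <= r -> 1 <= N.+1%:R * (th * y) ->
  big_le_prob P X s y r -> big_le_prob P X t th q ->
  big_le_prob P X (s + y `^ (- alpha) * t) (th * y) (r + N%:R * q).
Proof.
move=> s0 y0 th0 t0 q0 r0 Nz hr hq.
have t0' : 0 <= s + y `^ (- alpha) * t by rewrite addr_ge0// mulr_ge0// powR_ge0.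
have Nq0 : 0 <= N%:R * q by rewrite mulr_ge0.
have [Nq|Nq] := leP (N%:R * q) 1.
  apply: (big_le_prob_mono frag t0' (lexx _) (lexx _)) (big_le_prob_step s0 y0 th0 t0 q0 Nq Nz hr hq).
  by rewrite lerD2l ler_piMr// gerBl.
move=> i; have [x xE /andP[x0 x1]] := prE i t0' (array_big (th * y)).
by rewrite xE lee_fin (le_trans x1)// (le_trans (ltW Nq))// lerDr.
Qed.

(** With positive probability the partition has moved by some time; all blocks
   then have frequency less than 1, and uniformly so as there are finitely many
   types. *)
Lemma big_le_prob_start : nonconstant_partition P X -> exists t th q,
  [/\ 0 <= t, 2^-1 <= th < 1, 0 <= q < 1 & big_le_prob P X t th q].
Proof.
move=> ncst.
have ex i : exists tk : R * nat, 0 <= tk.1 /\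
    (P (one_block i) (at_time X tk.1 (big (1 - tk.2.+2%:R^-1 : R))) < 1)%E.
  have [t t0 ht] := nonconstant_cut frag i ncst.
  have := lt_le_trans ht (cut_small frag i t0) => hU.
  apply: contrapT => all1; move: hU; apply/negP; rewrite -leNgt.
  have : (P (one_block i)).-negligible
      (\bigcup_k at_time X t (~` big (1 - k.+2%:R^-1 : R))).
    apply: negligible_bigcup => k.
    have mk : measurable (big (1 - k.+2%:R^-1 : R) : set arrayType).
      exact: array_big.
    suff P0 : P (one_block i) (at_time X t (~` big (1 - k.+2%:R^-1 : R))) = 0%E.
      exists (at_time X t (~` big (1 - k.+2%:R^-1 : R))).
      by split; [exact: mat (array_bigC _)|exact: P0|].
    rewrite prC//; have [x xE /andP[x0 x1]] := prE i t0 mk; rewrite xE.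
    have [xlt|xge] := ltP x 1.
      by exfalso; apply: all1; exists (t, k); split=> //=; rewrite xE lte_fin.
    have -> : x = 1 by apply/eqP; rewrite eq_le x1.
    by rewrite -EFinB subrr.
  move/measure_negligible => -> //.
  by apply: bigcupT_measurable => k; exact: mat.
have /choice[f hf] := ex.
pose t := \sum_i (f i).1; pose k := \max_i (f i).2.
have t0 : 0 <= t by apply: sumr_ge0 => i _; exact: (hf i).1.
pose th : R := 1 - k.+2%:R^-1.
pose g i := fine (P (one_block i) (at_time X t (big th))).
exists t, th, (\big[Num.max/0]_i g i); split=> //.
- rewrite /th; apply/andP; split; last by rewrite ltrBlDr ltrDl invr_gt0.
  have : k.+2%:R^-1 <= 2^-1 :> R by rewrite lef_pV2 ?posrE ?ltr0n// ler_nat.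
  by move: k.+2%:R^-1 => x; lra.
- apply/andP; split; first exact: bigmax_ge_id.
  apply: bigmax_lt => // i _.
  have [x xE _] := prE i t0 (array_big th); rewrite /g xE/= -lte_fin -xE.
  apply: le_lt_trans (hf i).2.
  have fit : (f i).1 <= t.
    by rewrite /t (bigD1 i)//= lerDl sumr_ge0// => j _; exact: (hf j).1.
  apply: (le_trans (big_time_mono frag i th (hf i).1 fit)).
  apply: le_measure; rewrite ?inE; [apply: mat..|] => //; try exact: array_big; try exact: (hf i).1.
  move=> w; apply: big_le; rewrite /th lerD2l lerN2 lef_pV2 ?posrE ?ltr0n//.
  by rewrite ler_nat !ltnS; exact: (leq_bigmax (F := fun i => (f i).2)).
- move=> i; have [x xE _] := prE i t0 (array_big th).
  have := le_bigmax 0 g i; rewrite {1}/g.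
  by rewrite [P _ _]xE/= lee_fin.
Qed.

(** As long as y > 1/2, there is at most one block above th y >= 1/2, so that
   the largest frequency is multiplied by th with positive probability. *)
Lemma big_le_prob_half : nonconstant_partition P X -> exists t q,
  [/\ 0 < t, 0 <= q < 1 & big_le_prob P X t 2^-1 q].
Proof.
move=> /big_le_prob_start[t0 [th [q0 [t00 /andP[th2 th1] /andP[q00 q01] h0]]]].
have th0 : 0 < th by rewrite (lt_le_trans _ th2).
suff iter n : exists t q,
    [/\ 0 <= t, 0 <= q < 1 & big_le_prob P X t (Num.max 2^-1 (th ^+ n)) q].
  have [n hn] : exists n, th ^+ n <= 2^-1.
    have cv : th ^+ n @[n --> \oo] --> 0 by apply: cvg_expr; rewrite gtr0_norm.
    have /(cvgr_le _ cv)[n _ hn] : (0 : R) < 2^-1 by [].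
    by exists n; apply: hn => /=.
  have [t [q [t0' q01' h]]] := iter n.
  exists (t + 1), q; split=> //; first by rewrite ltr_wpDl.
  by move: h; rewrite max_l//; apply: (big_le_prob_mono frag) => //; rewrite lerDl.
elim: n => [|n [s [r [s0 /andP[r0 r1] hs]]]].
  exists 0, 0; split=> //; first by rewrite lexx ltr01.
  move=> i; rewrite expr0 max_r; last by lra.
  rewrite (_ : at_time X 0 (big 1) = set0) ?measure0//.
  by apply/seteqP; split=> w // /bigN1.
set y := Num.max _ _ in hs; set z := Num.max _ _.
have y2 : 2^-1 <= y by rewrite /y le_max lexx.
have z2 : 2^-1 <= z by rewrite /z le_max lexx.
have y0 : 0 < y by rewrite (lt_le_trans _ y2).
have thy : th <= z / y.
  rewrite ler_pdivlMr// /y maxr_pMr ?(ltW th0)// -exprS ge_max.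
  rewrite [X in _ && X]le_max lexx orbT andbT (le_trans _ z2)//.
  by rewrite ler_piMl// ltW.
have zyE : z / y * y = z by rewrite divfK// gt_eqF.
exists (s + y `^ (- alpha) * t0), (r + 1%:R * q0 * (1 - r)); split.
- by rewrite addr_ge0// mulr_ge0// powR_ge0.
- rewrite mul1r; apply/andP; split; first by rewrite addr_ge0// mulr_ge0//; lra.
  rewrite -subr_gt0; have -> : 1 - (r + q0 * (1 - r)) = (1 - q0) * (1 - r) by ring.
  by rewrite mulr_gt0// subr_gt0.
- rewrite -zyE; apply: big_le_prob_step => //.
  + by rewrite (lt_le_trans th0).
  + by rewrite mul1r ltW.
  + by rewrite zyE; lra.
  + exact: (big_le_prob_mono frag) h0.
Qed.

(** A block above 1/2 is unique, and it survives each period of length t with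
   probability at most q. *)
Lemma big_le_prob_geometric t q n : 0 <= t -> 0 <= q ->
  big_le_prob P X t 2^-1 q -> big_le_prob P X (n%:R * t) 2^-1 (q ^+ n).
Proof.
move=> t0 q0 h; elim: n => [|n IH] i.
  by rewrite mul0r expr0; apply: probability_le1; exact: mat (array_big _).
have mz : measurable (big (2^-1 : R) : set arrayType) by exact: array_big.
have nt0 : 0 <= n%:R * t by rewrite mulr_ge0.
have tn : n%:R * t <= n.+1%:R * t by rewrite ler_wpM2r// ler_nat.
apply: (le_trans (at_time_split frag i nt0 (le_trans nt0 tn) mz mz)).
rewrite [X in (_ + X)%E](big_time_new frag i _ nt0 tn) adde0.
have A1 : big (2^-1 : R) `<=` ~` big (1 : R) by move=> c _; exact: bigN1.
have h0 : (0 : R) < 2^-1 by [].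
have N1 : 1 <= 2%:R * (2^-1 * 1) :> R by rewrite mulr1 divff.
have := branch_step alpha0 frag i mz A1 nt0 ltr01 h0 t0 q0 N1 h.
have -> : n%:R * t + 1 `^ (- alpha) * t = n.+1%:R * t.
  by rewrite powR1 -[n.+1%:R]natr1 mulrDl.
rewrite mulr1 mul1r => e; apply: (le_trans e).
by rewrite exprS EFinM lee_wpmul2l// lee_fin.
Qed.

(** The time needed for all frequencies to fall from 2^-k to 2^-(k+1) is shorter
   by the factor lambda^k, lambda = 2^alpha; it is given the share
   lambda^k (n + L k) t of the total time, and f k is what remains of the total
   time a n + b. The failure probability 2^(k+1) q^(n + L k) of this level is at
   most 2 q^n 2^-k by the choice of L, and r k bounds the sum of those of the
   levels before k. *)
Lemma nondust_geometric : nonconstant_partition P X -> exists a b q,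
  [/\ 0 < a, 0 <= b, 0 <= q < 1 & forall n i,
    (P (one_block i) (at_time X (a * n%:R + b) nondust) <= (4 * q ^+ n)%:E)%E].
Proof.
move=> /big_le_prob_half[t [q [t0 /andP[q0 q1] hq]]].
pose lam : R := 2^-1 `^ (- alpha).
have lam0 : 0 < lam by rewrite powR_gt0.
have lam1 : lam < 1.
  rewrite (_ : 1 = 1 `^ (- alpha)); last by rewrite powR1.
  apply: gt0_ltr_powR; rewrite ?nnegrE ?oppr_gt0//.
  lra.
have lamX k : (2^-1 ^+ k) `^ (- alpha) = lam ^+ k.
  elim: k => [|k IH]; first by rewrite !expr0 powR1.
  by rewrite !exprS powRM ?exprn_ge0// IH.
have [L hL] : exists L, 2 * q ^+ L <= 2^-1.
  have cv : q ^+ n @[n --> \oo] --> 0 by apply: cvg_expr; rewrite ger0_norm.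
  have /(cvgr_le _ cv)[n _ hn] : (0 : R) < 4^-1 by [].
  by exists n; have := hn n (leqnn n); lra.
have lam1' : 1 - lam != 0 by rewrite gt_eqF// subr_gt0.
pose a := t / (1 - lam); pose b := lam * a * L%:R / (1 - lam).
have a0 : 0 < a by rewrite divr_gt0// subr_gt0.
have b0 : 0 <= b.
  rewrite divr_ge0 ?subr_ge0 ?(ltW lam1)// mulr_ge0// mulr_ge0//; exact: ltW.
exists a, b, q; split=> //; first by rewrite q0.
move=> n i.
pose f k := lam ^+ k * (a * (n + L * k)%:R + b).
have f0 : f 0%N = a * n%:R + b by rewrite /f expr0 mul1r muln0 addn0.
have f_ge0 k : 0 <= f k.
  apply: mulr_ge0; first by rewrite exprn_ge0// ltW.
  by rewrite addr_ge0// mulr_ge0// ltW.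
have fS k : f 0%N - f k.+1 = f 0%N - f k + lam ^+ k * ((n + L * k)%:R * t).
  have -> : t = a * (1 - lam) by rewrite /a divfK.
  rewrite /f !exprS mulnS addnCA natrD /b.
  by field.
have f_le k : 0 <= f 0%N - f k.
  elim: k => [|k IH]; first by rewrite subrr.
  rewrite fS addr_ge0// mulr_ge0//; first by rewrite exprn_ge0// ltW.
  by rewrite mulr_ge0// ltW.
pose r k : R := q ^+ n * (4 - 4 * 2^-1 ^+ k).
have r_le k : r k <= 4 * q ^+ n.
  by rewrite /r mulrC ler_wpM2r ?exprn_ge0// gerBl mulr_ge0// exprn_ge0.
have chain k : big_le_prob P X (f 0%N - f k) (2^-1 ^+ k) (r k).
  elim: k => [|k IH].
    move=> j; rewrite subrr expr0 (_ : at_time X 0 (big 1) = set0) ?measure0.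
      by rewrite lee_fin /r expr0 mulr1 subrr mulr0.
    by apply/seteqP; split=> w // /bigN1.
  have rS : r k + (2 ^ k.+1)%:R * q ^+ (n + L * k) <= r k.+1.
    have -> : r k.+1 = r k + 2 * 2^-1 ^+ k * q ^+ n.
      by rewrite /r exprS; field.
    rewrite lerD2l natrX exprS exprD mulrACA mulrA -!mulrA ler_wpM2l//.
    rewrite mulrC ler_wpM2r ?exprn_ge0// exprM -exprMn.
    by apply: lerXn2r => //; rewrite nnegrE ?mulr_ge0 ?exprn_ge0.
  have hk := @big_le_prob_geometric t q (n + L * k) (ltW t0) q0 hq.
  have y0 : (0 : R) < 2^-1 ^+ k by rewrite exprn_gt0.
  rewrite fS -lamX exprS; apply: (big_le_prob_mono frag _ (lexx _) (lexx _) rS).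
    by rewrite addr_ge0// mulr_ge0 ?powR_ge0// mulr_ge0// ltW.
  apply: big_le_prob_add => //.
  - by rewrite mulr_ge0// ltW.
  - by rewrite exprn_ge0.
  - rewrite /r mulr_ge0 ?exprn_ge0// subr_ge0 ler_piMr//.
    by rewrite exprn_ile1//; lra.
  - rewrite -exprS exprVn -[leLHS](divff (x := 2 ^+ k.+1)) ?expf_neq0//.
    by rewrite ler_wpM2r ?invr_ge0 ?exprn_ge0// -natrX ler_nat.
have all k : (P (one_block i) (at_time X (f 0%N) (big (2^-1 ^+ k : R))) <=
    (4 * q ^+ n)%:E)%E.
  apply: le_trans (_ : _ <= (r k)%:E)%E _; last by rewrite lee_fin.
  apply: (le_trans _ (chain k i)); apply: (big_time_mono frag) => //.
  by rewrite gerBl.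
have f00 : 0 <= f 0%N by exact: f_ge0.
rewrite -f0; apply: (le_trans (dust_big frag i f00)).
have -> : at_time X (f 0%N) (big (0 : R)) =
    \bigcup_k at_time X (f 0%N) (big (2^-1 ^+ k : R)) :> set Omega.
  apply/seteqP; split=> w; last first.
    by move=> [k _]; apply: big_le; rewrite exprn_ge0.
  move=> [m /exceedsP[e e0 [N hN]]].
  have [k hk] : exists k, 2^-1 ^+ k <= e / 2.
    have cv : (2^-1 : R) ^+ n @[n --> \oo] --> 0 by apply: cvg_expr; rewrite ger0_norm//; lra.
    have /(cvgr_le _ cv)[k _ hk] : 0 < e / 2 by lra.
    by exists k; apply: hk => /=.
  exists k => //; exists m; apply/exceedsP; exists (e / 2); first by lra.
  by exists N => n' /hN; apply: le_trans; lra.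
have mk k : measurable (at_time X (f 0%N) (big (2^-1 ^+ k : R))).
  exact: mat (array_big _).
pose F k := at_time X (f 0%N) (big (2^-1 ^+ k : R)).
have cv : P (one_block i) (F k) @[k --> \oo] --> P (one_block i) (\bigcup_k F k).
  apply: nondecreasing_cvg_mu => //; first exact: bigcupT_measurable.
  move=> k l kl; apply/subsetPset => w; apply: big_le.
  by rewrite ler_wiXn2l//; lra.
apply: (cvge_to_le cv).
by apply: nearW => k; exact: all.
Qed.

End iteration.

(** * From tails to exponential moments *)

(** The integral of a nonnegative function is a supremum over the simple
   functions below it, hence is monotone without measurability; the extinction
   time is an infimum over an uncountable set of times. *)
Lemma ge0_le_integral_unmeasurable d (T : measurableType d) (R : realType)
    (mu : {measure set T -> \bar R}) (f g : T -> \bar R) :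
  (forall x, 0 <= f x)%E -> (forall x, f x <= g x)%E ->
  (\int[mu]_x f x <= \int[mu]_x g x)%E.
Proof.
move=> f0 fg; have g0 x : (0 <= g x)%E by exact: le_trans (fg x).
rewrite !ge0_integralTE//; apply: ereal_sup_le => _ [h hf <-].
exists h => // x.
by apply: le_trans (fg x); exact: hf.
Qed.

(** The bound h is a constant plus the series of exp (c (a (n + 1) + b)) on B n. If
   k is the least index with w outside B k, then exp (c zt) is at most the term
   of index k - 1, or the constant if k = 0; if there is no such k, the series
   diverges. *)
Lemma exponential_moment d (T : measurableType d) (R : realType)
    (mu : probability T R) (zt : T -> \bar R) (B : nat -> set T) (a b q C : R) :
  0 < a -> 0 <= b -> 0 <= q < 1 -> 0 <= C -> (forall n, measurable (B n)) ->
  (forall n, (mu (B n) <= (C * q ^+ n)%:E)%E) ->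
  (forall n w, ~ B n w -> (zt w <= (a * n%:R + b)%:E)%E) ->
  {ae mu, forall w, (zt w < +oo)%E} /\
  exists2 c : R, 0 < c & (\int[mu]_w expeR (c%:E * zt w) < +oo)%E.
Proof.
move=> a0 b0 /andP[q0 q1] C0 mB muB ztB; split.
  exists (\bigcap_n B n); split; first exact: bigcapT_measurable.
  - have mI : measurable (\bigcap_n B n) by exact: bigcapT_measurable.
    have le n : (mu (\bigcap_n B n) <= (C * q ^+ n)%:E)%E.
      apply: le_trans (muB n); apply: le_measure; rewrite ?inE//.
      by move=> w; apply.
    have ge0 : (0 <= mu (\bigcap_n B n))%E by exact: measure_ge0.
    case E : (mu (\bigcap_n B n)) le ge0 => [x| |] le ge0//; last first.
      by have := le 0%N.
    congr (_%:E); apply/eqP; rewrite eq_le; apply/andP; split; last by rewrite -lee_fin.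
    have cv : C * q ^+ n @[n --> \oo] --> (0 : R).
      rewrite -[X in _ --> X](mulr0 C); apply: cvgMr; apply: cvg_expr.
      by rewrite ger0_norm.
    by apply: (cvgr_to_ge cv); apply: nearW => n; rewrite -lee_fin.
  - move=> w /= ztw n _; apply: contrapT => nB; apply: ztw.
    by rewrite (le_lt_trans (ztB _ _ nB))// ltry.
(* c is chosen so that x = exp (c a) satisfies x q < 1. *)
have [x x1 xq] : exists2 x : R, 1 < x & x * q < 1.
  have q10 : 0 < 1 + q by lra.
  exists (2 / (1 + q)); first by rewrite ltr_pdivlMr//; lra.
  by rewrite mulrAC ltr_pdivrMr//; lra.
have xq0 : 0 <= x * q by rewrite mulr_ge0//; lra.
have [c c0 ca] : exists2 c : R, 0 < c & expR (c * a) = x.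
  exists (ln x / a); first by rewrite divr_gt0// ln_gt0.
  by rewrite divfK ?gt_eqF// lnK// posrE; lra.
exists c => //.
pose v n : R := expR (c * (a * n.+1%:R + b)).
have vE n : v n = expR (c * b) * x * x ^+ n.
  rewrite /v -ca -!expRM_natl -!expRD; congr expR.
  by rewrite -natr1; ring.
pose h w : \bar R := ((expR (c * b))%:E + \sum_(0 <= n <oo) (v n)%:E * (\1_(B n) w)%:E)%E.
have u0 w n : (0 <= (v n)%:E * (\1_(B n) w)%:E)%E.
  by rewrite mule_ge0// lee_fin// expR_ge0.
have s0 w : (0 <= \sum_(0 <= n <oo) (v n)%:E * (\1_(B n) w)%:E)%E.
  by apply: nneseries_ge0 => n _ _; exact: u0.
have ind1 n w : B n w -> \1_(B n) w = 1 :> R by move=> Bw; rewrite indicE mem_set.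
have bound w : (expeR (c%:E * zt w) <= h w)%E.
  have le n : ~ B n w -> (expeR (c%:E * zt w) <= (expR (c * (a * n%:R + b)))%:E)%E.
    move=> nB; rewrite -[leRHS]/(expeR (c * (a * n%:R + b))%:E) lee_expeR EFinM.
    by apply: lee_wpmul2l; [rewrite lee_fin ltW|exact: ztB].
  have [[n nB]|allB] := pselect (exists n, ~ B n w).
    have ex : exists n, `[< ~ B n w >] by exists n; exact/asboolP.
    case: (ex_minnP ex) => [[|k]] /asboolP nBk kmin.
      apply: (le_trans (le _ nBk)); rewrite mulr0 add0r /h.
      by rewrite leeDl.
    have Bk : B k w.
      by apply: contrapT => /asboolP /kmin; rewrite ltnn.
    apply: (le_trans (le _ nBk)); rewrite -/(v k) /h.
    apply: (@le_trans _ _ (\sum_(0 <= n < k.+1) (v n)%:E * (\1_(B n) w)%:E)%E).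
      by rewrite big_nat_recr//= ind1// mule1 leeDr// sume_ge0.
    apply: (le_trans (nneseries_lim_ge _ _)); first by move=> m _ _; exact: u0.
    by rewrite leeDr// lee_fin expR_ge0.
  suff -> : h w = +oo%E by rewrite leey.
  have Bw n : B n w by apply: contrapT => nB; apply: allB; exists n.
  rewrite /h (_ : \sum_(0 <= n <oo) _ = +oo)%E ?addey//.
  apply/eqyP => r r0; apply: (@le_trans _ _ (\sum_(0 <= n < (Num.truncn r).+1) (v n)%:E * (\1_(B n) w)%:E)%E).
    apply: (@le_trans _ _ (\sum_(0 <= n < (Num.truncn r).+1) 1%:E)%E).
      by rewrite sumEFin lee_fin big_const_nat subn0 iter_addr_0 ltW// truncnS_gt.
    apply: lee_sum => n _; rewrite ind1// mule1 lee_fin /v -[leLHS]expR0 ler_expR.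
    by rewrite mulr_ge0 ?(ltW c0)// addr_ge0// mulr_ge0// ltW.
  by apply: nneseries_lim_ge => m _ _; exact: u0.
apply: (@le_lt_trans _ _ (\int[mu]_w h w)%E).
  by apply: ge0_le_integral_unmeasurable => // w; exact: expeR_ge0.
have mu_ n : measurable_fun setT (fun w => (v n)%:E * (\1_(B n) w)%:E)%E.
  by apply: emeasurable_funM => //; apply/measurable_EFinP; exact: measurable_indic.
rewrite /h ge0_integralD//; last first.
  exact: ge0_emeasurable_sum.
rewrite integral_cst// [X in (_ * X + _)%E](_ : _ = 1%E); last exact: probability_setT.
rewrite mule1 integral_nneseries//.
apply: lte_add_pinfty; first exact: ltry.
apply: (@le_lt_trans _ _ (expR (c * b) * x * C / (1 - x * q))%:E); last exact: ltry.
apply: lime_le.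
  apply: is_cvg_nneseries => n _ _; apply: integral_ge0 => w _; exact: u0.
apply: nearW => n.
apply: (@le_trans _ _ (\sum_(0 <= k < n) (expR (c * b) * x * C * (x * q) ^+ k)%:E)%E).
  apply: lee_sum => k _; rewrite ge0_integralZl//; last 2 first.
  - by apply/measurable_EFinP; exact: measurable_indic.
  - by rewrite lee_fin expR_ge0.
  rewrite integral_indic// setIT.
  apply: (le_trans (lee_wpmul2l _ (muB k))); first by rewrite lee_fin expR_ge0.
  rewrite -EFinM lee_fin vE exprMn.
  by rewrite mulrACA.
rewrite sumEFin lee_fin -mulr_sumr ler_wpM2l//.
  by rewrite !mulr_ge0 ?expR_ge0//; lra.
rewrite -[leRHS]mul1r ler_pdivlMr ?subr_gt0//.
have -> : (\sum_(0 <= k < n) (x * q) ^+ k) * (1 - x * q) = 1 - (x * q) ^+ n.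
  by rewrite big_mkord mulrC -[1 - x * q]opprB mulNr -subrX1 opprB.
by rewrite gerBl exprn_ge0.
Qed.

Theorem proposition2p14 (R : realType) (K : nat) (alpha : R)
    (d : measure_display) (Omega : measurableType d)
    (P : tpart R K setT -> probability Omega R)
    (X : R -> Omega -> tpart R K setT) :
  (0 < K)%N -> alpha < 0 ->
  self_similar_fragmentation alpha P X -> nonconstant_partition P X ->
  forall i : 'I_K,
    {ae P (one_block i), forall w, (zeta X w < +oo)%E} /\
    exists2 a : R, 0 < a &
      (\int[P (one_block i)]_w expeR (a%:E * zeta X w) < +oo)%E.
Proof.
move=> _ alpha0 frag ncst i.
have [a [b [q [a0 b0 q01 tail]]]] := nondust_geometric alpha0 frag ncst.
have t0 n : 0 <= a * n%:R + b by rewrite addr_ge0// mulr_ge0// ltW.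
apply: (@exponential_moment _ _ _ _ _
  (fun n => at_time X (a * n%:R + b) nondust) a b q 4) => //.
- by move=> n; apply: (measurable_at_time frag) => //; exact: array_nondust.
- move=> n w dust; apply: ereal_inf_lbound; exists (a * n%:R + b) => //.
  split=> // m; apply/seteqP; split=> j /= => [mj|->]; last exact: cls_refl.
  by apply: contrapT => jm; apply: dust; exists m, j; split=> //; apply/eqP => e; apply: jm.
Qed.
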